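(* The operator $L_{\mu,\nu}$ generates the following symmetric Dirichlet form: for all smooth functions $u,g$ on $S^{n-1}$, $$\int_{S^{n-1}}h\,\Big\langle\nabla_{S^{n-1}}g,\,(D^2h)^{-1}\nabla_{S^{n-1}}\Big(\frac uh\Big)\Big\rangle\,d\mu=-\int_{S^{n-1}}g\,L_{\mu,\nu}\Big(\frac uh\Big)\,d\mu .$$
   Context: $S^{n-1}$ is the unit sphere in $\mathbb{R}^n$, $\sigma$ the uniform probability measure on it; $\nabla_{S^{n-1}}$ and $\nabla^2_{S^{n-1}}$ are the spherical gradient and Hessian; $D^2f(x)=f(x)\,\mathrm{Id}+\nabla^2_{S^{n-1}}f(x)$, acting on the tangent space of $S^{n-1}$ at $x$. Standing setting: $\mu=e^{-V}\cdot\sigma$ and $\nu=e^{-W}\cdot\sigma$ are probability measures on $S^{n-1}$, and $$T(x)=\frac{h(x)\,x+\nabla_{S^{n-1}}h(x)}{\sqrt{h^2(x)+|\nabla_{S^{n-1}}h(x)|^2}}$$ is the optimal transportation mapping pushing forward $\mu$ onto $\nu$ for the cost $c(x,y)=\log\frac1{\langle x,y\rangle}$ if $\langle x,y\rangle>0$, $c=+\infty$ otherwise; here $h>0$ is the (restriction to $S^{n-1}$ of the) support function of a compact convex body containing the origin in its interior. The densities of $\mu,\nu$, the function $h$ and the map $T$ are smooth, and $D^2h(x)>0$ for all $x\in S^{n-1}$. The operator $L_{\mu,\nu}$ is defined by $$L_{\mu,\nu}\Big(\frac uh\Big)=\mathrm{Tr}\big[(D^2h)^{-1}D^2u\big]-\Big\langle\nabla_{S^{n-1}}W(T)+nT,\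 \frac{u\,x+\nabla_{S^{n-1}}u}{\sqrt{h^2+|\nabla_{S^{n-1}}h|^2}}\Big\rangle+\frac uh .$$ *)

(* Defs.v *)
(* Vectors of R^n are row vectors 'rV[R]_n; operators act on the right,
   v |-> v *m A. *)
From mathcomp Require Import all_boot all_order all_algebra.
From mathcomp Require Import all_classical all_reals all_analysis.

Set Implicit Arguments.
Unset Strict Implicit.
Unset Printing Implicit Defensive.

Import Order.TTheory GRing.Theory Num.Theory.
Import numFieldNormedType.Exports.

Local Open Scope classical_set_scope.
Local Open Scope ring_scope.

Section EuclideanSphere.
Context {R : realType} {n : nat}.
Implicit Types (x y v : 'rV[R]_n) (f g h u : 'rV[R]_n -> R).

(* The library norm on 'rV[R]_n is the sup norm, hence the explicit Euclidean
   structure below. *)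
Definition dot x y : R := \sum_(i < n) x 0 i * y 0 i.

Definition enorm x : R := Num.sqrt (dot x x).

Definition sphere : set 'rV[R]_n := [set x | dot x x = 1].

Definition normalize x : 'rV[R]_n := (enorm x)^-1 *: x.

Fixpoint Ck (k : nat) (U : set 'rV[R]_n) f : Prop :=
  (forall x, U x -> {for x, continuous f}) /\
  if k is k'.+1 then
    forall i : 'I_n, (forall x, U x -> derivable f x (delta_mx 0 i)) /\
      Ck k' U (fun x => 'D_(delta_mx 0 i) f x)
  else True.

(* A function on the sphere is represented by an ambient function of which only
   the values on the sphere matter: all the differential notions go through the
   0-homogeneous extension [f \o normalize], defined near the sphere. *)
Definition smooth f : Prop :=
  forall k, Ck k [set x | x != 0] (f \o normalize).

Definition sgrad f x : 'rV[R]_n :=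
  \row_(i < n) 'D_(delta_mx 0 i) (f \o normalize) x.

(* Orthogonal projection onto the tangent space of the sphere at x. *)
Definition tproj x : 'M[R]_n := 1%:M - x^T *m x.

(* Covariant derivative of the gradient field: the tangential projection of the
   derivative of [sgrad f] along the sphere. As for every operator on the
   tangent space at x below, the matrix is the one of its extension by 0 to the
   normal line spanned by x. *)
Definition shess f x : 'M[R]_n :=
  tproj x *m 'J (sgrad f \o normalize) x *m tproj x.

Definition D2 f x : 'M[R]_n := f x *: tproj x + shess f x.

Definition D2_pos f : Prop :=
  forall x v, sphere x -> dot x v = 0 -> v != 0 -> 0 < dot (v *m D2 f x) v.

(* Inverse, on the tangent space at x, of an operator A of this space; see
   [tinv_spec]. *)
Definition tinv x (A : 'M[R]_n) : 'M[R]_n := invmx (A + x^T *m x) - x^T *m x.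

Lemma tinv_spec x (A : 'M[R]_n) :
  sphere x -> tproj x *m A = A -> A *m tproj x = A ->
  (forall v, dot x v = 0 -> v *m A = 0 -> v = 0) ->
  [/\ A *m tinv x A = tproj x, tinv x A *m A = tproj x,
      tproj x *m tinv x A = tinv x A & tinv x A *m tproj x = tinv x A].
Proof.
move=> Sx PA AP A0.
have dE (v w : 'rV[R]_n) : v *m w^T = (dot v w)%:M.
  apply/matrixP => i j; rewrite !ord1 !mxE /= mulr1n /dot.
  by apply: eq_bigr => k _; rewrite mxE.
have xx : x *m x^T = 1%:M by rewrite dE Sx.
set N := x^T *m x.
have NN : N *m N = N by rewrite /N mulmxA -(mulmxA _ x) xx mulmx1.
have NA : N *m A = 0.
  by move/eqP: PA; rewrite /tproj mulmxBl mul1mx subr_eq addrC -subr_eq subrr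
    => /eqP <-.
have AN : A *m N = 0.
  by move/eqP: AP; rewrite /tproj mulmxBr mulmx1 subr_eq addrC -subr_eq subrr
    => /eqP <-.
have U : A + N \in unitmx.
  rewrite -row_free_unit -kermx_eq0; apply/eqP/row_matrixP => i.
  rewrite row0; set v := row i _.
  have vAN : v *m (A + N) = 0 by apply/sub_kermxP; exact: row_sub.
  have vN : v *m N = 0.
    by rewrite -[N]NN -[N *m N]add0r -AN -mulmxDl mulmxA vAN mul0mx.
  have vx : dot x v = 0.
    have : v *m N *m x^T = 0 by rewrite vN mul0mx.
    rewrite /N -!mulmxA xx mulmx1 dE => /matrixP/(_ 0 0).
    rewrite !mxE /= mulr1n => <-.
    by rewrite /dot; apply: eq_bigr => k _; rewrite mulrC.
  apply: A0 => //.
  by move: vAN; rewrite mulmxDr vN addr0.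
have NV : N *m invmx (A + N) = N.
  by rewrite -{1}NN -[N *m N]add0r -NA -mulmxDr mulmxK.
have VN : invmx (A + N) *m N = N.
  by rewrite -{2}NN -[N *m N]add0r -AN -mulmxDl mulKmx.
split; rewrite /tinv /tproj -/N.
- by rewrite mulmxBr AN subr0 -[X in X *m _](addrK N) mulmxBl mulmxV // NV.
- by rewrite mulmxBl NA subr0 -[X in _ *m X](addrK N) mulmxBr mulVmx // VN.
- by rewrite mulmxBr mulmxBl !mulmxBl !mul1mx NV NN subrr subr0.
- by rewrite mulmxBr mulmx1 mulmxBl VN NN subrr subr0.
Qed.

(* The support function, on the sphere, of a compact convex set with the origin
   in its interior. *)
Definition is_support_function h : Prop :=
  exists K : set 'rV[R]_n,
    [/\ compact K, convex_set (K : set (convex_lmodType 'rV[R]_n)),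
        K° 0 & forall x, sphere x -> h x = sup [set dot x y | y in K]].

Definition ray_norm h x : R := Num.sqrt (h x ^+ 2 + dot (sgrad h x) (sgrad h x)).

Definition Tmap h x : 'rV[R]_n := (ray_norm h x)^-1 *: (h x *: x + sgrad h x).

(* As an operator on functions f; [f = u / h] gives back the formula in u. *)
Definition Lop (W h f : 'rV[R]_n -> R) x : R :=
  let u y := h y * f y in
  \tr (D2 u x *m tinv x (D2 h x))
  - dot (sgrad W (Tmap h x) + n%:R *: Tmap h x)
        ((ray_norm h x)^-1 *: (u x *: x + sgrad u x))
  + f x.

End EuclideanSphere.

Definition borel_rV (R : realType) (n : nat) :=
  g_sigma_algebraType (@open 'rV[R]_n).

Section Measures.
Context {R : realType} {n : nat}.
Implicit Types (sigma mu nu : probability (borel_rV R n) R).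
Implicit Types (f g h V W : 'rV[R]_n -> R) (S T : 'rV[R]_n -> 'rV[R]_n).

(* The uniform probability measure on the sphere, as the (unique) Borel
   probability measure of R^n that is carried by the sphere and invariant under
   the orthogonal group. *)
Definition uniform_sphere sigma : Prop :=
  sigma sphere = 1%E /\
  forall Q : 'M[R]_n, Q *m Q^T = 1%:M ->
    forall A : set (borel_rV R n), measurable A ->
      sigma [set x | A (x *m Q)] = sigma A.

(* mu = e^{-V} . sigma *)
Definition gibbs sigma V mu : Prop :=
  forall A : set (borel_rV R n), measurable A ->
    mu A = (\int[sigma]_(x in sphere `&` A) (expR (- V x))%:E)%E.

Definition cost (x y : 'rV[R]_n) : \bar R :=
  if 0 < dot x y then (ln (dot x y)^-1)%:E else +oo%E.

Definition transports mu nu T : Prop :=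
  [/\ measurable_fun (sphere : set (borel_rV R n))
        (T : borel_rV R n -> borel_rV R n),
      forall x, sphere x -> sphere (T x) &
      forall A : set (borel_rV R n), measurable A ->
        mu (sphere `&` T @^-1` A) = nu A].

Definition optimal_transport mu nu T : Prop :=
  transports mu nu T /\
  forall S, transports mu nu S ->
    (\int[mu]_(x in sphere) cost x (T x) <=
     \int[mu]_(x in sphere) cost x (S x))%E.

Definition dirichlet_energy mu h g f : R :=
  (\int[mu]_(x in sphere)
     (h x * dot (sgrad g x) (sgrad f x *m tinv x (D2 h x))))%R.

(* Symmetric forms whose closure in L^2(mu) is a Dirichlet form: a symmetric,
   nonnegative, closable, Markovian form E with domain D (see Fukushima, Oshima
   and Takeda, Dirichlet forms and symmetric Markov processes, section 1.1). *)
Record symmetric_dirichlet mu (D : set ('rV[R]_n -> R))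
    (E : ('rV[R]_n -> R) -> ('rV[R]_n -> R) -> R) : Prop := {
  dirichlet_lin : forall (a : R) f g, D f -> D g -> D (fun x => a * f x + g x);
  dirichlet_L2 : forall f, D f ->
    mu.-integrable (sphere : set (borel_rV R n)) (fun x => (f x ^+ 2)%:E);
  dirichlet_bilin : forall (a : R) f1 f2 g, D f1 -> D f2 -> D g ->
    E (fun x => a * f1 x + f2 x) g = a * E f1 g + E f2 g;
  dirichlet_sym : forall f g, D f -> D g -> E f g = E g f;
  dirichlet_ge0 : forall f, D f -> 0 <= E f f;
  dirichlet_closable : forall f_ : nat -> 'rV[R]_n -> R, (forall k, D (f_ k)) ->
    (fun p : nat * nat => E (f_ p.1 \- f_ p.2) (f_ p.1 \- f_ p.2))
      @ (\oo, \oo) --> (0 : R) ->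
    (fun k => \int[mu]_(x in sphere) (f_ k x ^+ 2))%R @ \oo --> (0 : R) ->
    (fun k => E (f_ k) (f_ k)) @ \oo --> (0 : R);
  dirichlet_markov : forall e : R, 0 < e ->
    exists phi : R -> R,
      [/\ forall t, 0 <= t <= 1 -> phi t = t,
          forall t, - e <= phi t <= 1 + e,
          forall s t, s < t -> 0 <= phi t - phi s <= t - s &
          forall f, D f -> D (phi \o f) /\ E (phi \o f) (phi \o f) <= E f f] }.

End Measures.

(* Main.v *)
From HB Require Import structures.
Require Import Defs.
From mathcomp Require Import all_boot all_order all_algebra.
From mathcomp Require Import all_classical all_reals all_analysis.
From mathcomp Require Import measurable_realfun ring lra.

(** Write [T] for [Tmap h] and [r] for [ray_norm h]. For a function [f] on the sphere,
[grad1 f x = f x *: x + sgrad f x] is the gradient of its 1-homogeneous extension.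
Thus [T] is [grad1 h] normalized, and [D2 f] is the Jacobian matrix of [grad1 f]
([hasjac_grad1]).

The integration by parts is the divergence theorem on the target side. When [h]
moves in the direction [u], the point [T x] moves with a velocity which is the
component of [grad1 u x / r x] tangent to the sphere at [T x]. Multiply it by [g x]
and call [Y] the tangent field obtained at [y = T x]. For the measure
[nu = exp (- W) sigma] the divergence theorem says that [div Y - <grad W, Y>] has
integral 0; as [T] transports [mu] to [nu], the function
[(div Y - <grad W, Y>) \o T] has integral 0 against [mu]. A computation shows that
this function is the sum of the two integrands of the theorem
([divergence_velocity]): writing [u = h * f], one has
[grad1 u = f *: grad1 h + h *: sgrad f], where the first term is normal to the sphere
at [T x], and the derivative of the inverse of [T] is explicit in terms of
[(D2 h)^-1] ([dTinv]).

This needs [T] to be a diffeomorphism of the sphere. It is injective because the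
1-homogeneous extension of [h] is strictly convex across rays ([Tmap_inj]),
surjective because [y] is the image of a maximum point of [dot x y / h x]
([Tmap_surj]), and its inverse is continuous by compactness, hence differentiable.
The divergence theorem ([divergence_sphere]) is derived from the rotation
invariance that characterizes [sigma], by differentiating integrals along the
rotations of the coordinate planes.

The form is symmetric and nonnegative because [(D2 h)^-1] is. It is closable because,
for a fixed smooth second argument, the integration by parts makes it continuous
in the first one for the L^2 norm ([energy_closable]). It is Markovian by the chain
rule, applied to a smooth function that is the identity on [[0, 1]] and has
derivative between 0 and 1; this function is built from [exp (- 1 / s)]
([soft_clip]). *)

Set Implicit Arguments.
Unset Strict Implicit.
Unset Printing Implicit Defensive.

Import Order.TTheory GRing.Theory Num.Theory.
Import numFieldNormedType.Exports.

Local Open Scope classical_set_scope.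
Local Open Scope ring_scope.

(** * The dot product *)

Section Dot.
Context {R : realType} {n : nat}.
Implicit Types (x y v : 'rV[R]_n).

Lemma dotE x y : dot x y = (x *m y^T) 0 0.
Proof. by rewrite mxE; apply: eq_bigr => i _; rewrite mxE. Qed.

Lemma mulmx_tr_dot x y : x *m y^T = (dot x y)%:M.
Proof.
by apply/matrixP => i j; rewrite !ord1 dotE [RHS]mxE mulr1n.
Qed.

Lemma dotC x y : dot x y = dot y x.
Proof. by apply: eq_bigr => i _; rewrite mulrC. Qed.

Lemma dotDl x y z : dot (x + y) z = dot x z + dot y z.
Proof. by rewrite !dotE mulmxDl mxE. Qed.

Lemma dotZl a x z : dot (a *: x) z = a * dot x z.
Proof. by rewrite !dotE -scalemxAl mxE. Qed.

Lemma dotDr x y z : dot z (x + y) = dot z x + dot z y.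
Proof. by rewrite dotC dotDl !(dotC z). Qed.

Lemma dotZr a x z : dot z (a *: x) = a * dot z x.
Proof. by rewrite dotC dotZl dotC. Qed.

Lemma dotNl x z : dot (- x) z = - dot x z.
Proof. by rewrite -scaleN1r dotZl mulN1r. Qed.

Lemma dotNr x z : dot z (- x) = - dot z x.
Proof. by rewrite -scaleN1r dotZr mulN1r. Qed.

Lemma dot0l x : dot 0 x = 0.
Proof. by rewrite dotE mul0mx mxE. Qed.

Lemma dot0r x : dot x 0 = 0.
Proof. by rewrite dotC dot0l. Qed.

Lemma dot_delta x i : dot (delta_mx 0 i) x = x 0 i.
Proof.
rewrite /dot (bigD1 i)//= big1 => [|j ji]; first by rewrite mxE !eqxx mul1r addr0.
by rewrite mxE (negPf ji) andbF mul0r.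
Qed.

Lemma dot_ge0 x : 0 <= dot x x.
Proof. by apply: sumr_ge0 => i _; rewrite -expr2 sqr_ge0. Qed.

Lemma dot_eq0 x : (dot x x == 0) = (x == 0).
Proof.
apply/eqP/eqP => [|->]; last by rewrite dot0l.
move=> /eqP; rewrite psumr_eq0 => [/allP x0|i _]; last by rewrite -expr2 sqr_ge0.
apply/rowP => i; rewrite mxE.
by have := x0 i (mem_index_enum _); rewrite -expr2 sqrf_eq0 => /eqP.
Qed.

Lemma dot_gt0 x : x != 0 -> 0 < dot x x.
Proof. by move=> x0; rewrite lt_neqAle dot_ge0 eq_sym dot_eq0 x0. Qed.

Lemma dot_mulmx x y (A : 'M[R]_n) : dot (x *m A) y = dot x (y *m A^T).
Proof. by rewrite !dotE trmx_mul trmxK mulmxA. Qed.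

Lemma dot_inj x y : (forall v, dot v x = dot v y) -> x = y.
Proof. by move=> xy; apply/rowP => i; rewrite -!dot_delta. Qed.

End Dot.

(** * Gradients and Jacobian matrices *)

Section Gradient.
Context {R : realType} {n : nat}.
Implicit Types (x v d : 'rV[R]_n) (f g : 'rV[R]_n -> R).

(** The differential is recorded by a row vector, so that the calculus below is
plain vector and matrix algebra. *)
Definition hasgrad f x d : Prop :=
  differentiable f x /\ forall v, 'd f x v = dot v d.

Lemma hasgrad_is_diff f x d :
  hasgrad f x d <-> is_diff x f (fun v => dot v d).
Proof.
split=> [[df dE]|[df dE]]; last by split=> // v; rewrite dE.
by apply: DiffDef => //; apply/funext => v; rewrite dE.
Qed.

Lemma dot_lin_subproof d : linear (fun v => dot v d : R).
Proof. by move=> a u v; rewrite dotDl dotZl. Qed.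

Lemma dot_continuous d : continuous (fun v => dot v d : R).
Proof.
rewrite /dot.
have ac : continuous (fun x : R * R => x.1 + x.2) by exact: add_continuous.
apply: (@continuous_big _ _ _ _ _ ac).
move=> i _ v; apply: (@continuousM R _ (fun v : 'rV[R]_n => v 0 i) (fun=> d 0 i)).
  exact: coord_continuous.
exact: cst_continuous.
Qed.

(** The form in which gradients are established by estimates: it involves no
linear map and no asymptotic notation. *)
Lemma hasgradP f x d : hasgrad f x d <->
  forall e, 0 < e ->
    \forall v \near (0 : 'rV[R]_n), `|f (v + x) - f x - dot v d| <= e * `|v|.
Proof.
pose dM := GRing.isLinear.Build _ _ _ _ _ (dot_lin_subproof d).
pose dL : {linear 'rV[R]_n -> R} := HB.pack (fun v => dot v d : R) dM.
split=> [[df dE] e e0|fd].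
  have /eqaddoP /(_ e e0) := diff_locally df.
  apply: filterS => v /=.
  by rewrite -[X in `|X|]/(f (v + x) - (f x + 'd f x v)) dE opprD addrA.
have E : f \o shift x = cst (f x) + (dL : 'rV[R]_n -> R) +o_ (0 : 'rV[R]_n) id.
  apply/eqaddoP => e e0; have := fd e e0; apply: filterS => v.
  by rewrite -[X in _ -> `|X| <= _]/(f (v + x) - (f x + dot v d)) opprD addrA.
have dc : continuous dL by exact: dot_continuous.
have D := diff_unique dc E.
split; last by move=> v; rewrite D.
by apply/diff_locallyP; rewrite D.
Qed.

Lemma hasgrad_uniq f x d d' : hasgrad f x d -> hasgrad f x d' -> d = d'.
Proof. by move=> [_ h] [_ h']; apply: dot_inj => v; rewrite -h h'. Qed.

Lemma hasgrad_derive f x d v : hasgrad f x d -> is_derive x v f (dot v d).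
Proof.
move=> [df dE]; apply: DeriveDef; first exact: diff_derivable.
by rewrite deriveE.
Qed.

Lemma hasgrad_grad f x d : hasgrad f x d ->
  d = \row_i 'D_(delta_mx 0 i) f x.
Proof.
move=> fd; apply/rowP => i; rewrite mxE.
by rewrite (@derive_val _ _ _ _ _ _ _ (hasgrad_derive (delta_mx 0 i) fd)) dot_delta.
Qed.

Lemma hasgrad_continuous f x d : hasgrad f x d -> {for x, continuous f}.
Proof. by move=> [/differentiable_continuous]. Qed.

Lemma hasgrad_near f g x d : (\near x, f x = g x) ->
  hasgrad f x d -> hasgrad g x d.
Proof.
move=> fg /hasgradP fd; apply/hasgradP => e e0; have := fd e e0.
rewrite -(nbhs_singleton fg) => fd'.
have fg' : \forall v \near (0 : 'rV[R]_n), f (v + x) = g (v + x).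
  by move: fg; rewrite (near_shift 0) /=; apply: filterS => v; rewrite subr0.
by near=> v; rewrite -(near fg' v)//; near: v.
Unshelve. all: by end_near. Qed.

Lemma hasgrad_cst (a : R) x : hasgrad (fun=> a) x 0.
Proof.
apply/hasgradP => e e0; near=> v.
by rewrite subrr dot0r subr0 normr0 mulr_ge0// ltW.
Unshelve. all: by end_near. Qed.

Lemma hasgradD f g x d d' : hasgrad f x d -> hasgrad g x d' ->
  hasgrad (fun y => f y + g y) x (d + d').
Proof.
move=> /hasgrad_is_diff fd /hasgrad_is_diff gd; apply/hasgrad_is_diff.
apply: is_diff_eq; apply/funext => v /=.
by rewrite dotDr.
Qed.

Lemma hasgradM f g x d d' : hasgrad f x d -> hasgrad g x d' ->
  hasgrad (fun y => f y * g y) x (f x *: d' + g x *: d).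
Proof.
move=> /hasgrad_is_diff fd /hasgrad_is_diff gd; apply/hasgrad_is_diff.
apply: is_diff_eq; apply/funext => v /=.
by rewrite dotDr !dotZr.
Qed.

Lemma hasgradZ (a : R) g x d : hasgrad g x d ->
  hasgrad (fun y => a * g y) x (a *: d).
Proof.
move=> gd; have := hasgradM (hasgrad_cst a x) gd.
by rewrite scaler0 addr0.
Qed.

Lemma hasgradN g x d : hasgrad g x d -> hasgrad (fun y => - g y) x (- d).
Proof.
move=> /(hasgradZ (-1)); rewrite scaleN1r => h.
by under eq_fun do rewrite -mulN1r.
Qed.

Lemma hasgrad_sum (I : Type) (r : seq I) (F : I -> 'rV[R]_n -> R) x (D : I -> 'rV[R]_n) :
  (forall i, hasgrad (F i) x (D i)) ->
  hasgrad (fun y => \sum_(i <- r) F i y) x (\sum_(i <- r) D i).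
Proof.
move=> FD; elim: r => [|i r IH].
  by under eq_fun do rewrite big_nil; rewrite big_nil; exact: hasgrad_cst.
by under eq_fun do rewrite big_cons; rewrite big_cons; exact: hasgradD.
Qed.

Lemma hasgrad_coord i x : hasgrad (fun y => y 0 i) x (delta_mx 0 i).
Proof.
apply/hasgradP => e e0; near=> v.
by rewrite mxE addrK dotC dot_delta subrr normr0 mulr_ge0// ltW.
Unshelve. all: by end_near. Qed.

Lemma hasgrad_comp1 (phi : R -> R) f x d a : hasgrad f x d ->
  is_derive (f x) 1 phi a -> hasgrad (fun y => phi (f y)) x (a *: d).
Proof.
move=> /hasgrad_is_diff fd pd; apply/hasgrad_is_diff.
have pdd : derivable phi (f x) 1 by have [] := pd.
have dp : differentiable phi (f x) by exact/derivable1_diffP.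
have pD : is_diff (f x) phi ('d phi (f x)) by exact: differentiableP.
have := @is_diff_comp _ _ _ _ f _ phi _ x fd pD.
rewrite -[phi \o f]/(fun y => phi (f y)) => h.
apply: is_diff_eq; apply/funext => v /=.
by rewrite deriv1E// derive1E derive_val dotZr /GRing.scale /= mulrC.
Qed.

Lemma hasgradV f x d : hasgrad f x d -> f x != 0 ->
  hasgrad (fun y => (f y)^-1) x (- (f x) ^- 2 *: d).
Proof.
move=> fd f0; apply: hasgrad_comp1 => //.
apply: DeriveDef; first by apply: derivableV => //; exact: derivable_id.
by rewrite (@deriveV _ _ id)// derive_id /GRing.scale /= mulr1.
Qed.

End Gradient.

Section Jacobian.
Context {R : realType}.

Lemma rV_normP n (v : 'rV[R]_n) (e : R) : 0 <= e ->
  (`|v| <= e) <-> (forall i, `|v 0 i| <= e).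
Proof.
move=> e0; rewrite [`|v|]mx_normrE; split=> [/bigmax_leP[_ ve] i|ve].
  exact: (ve (0, i)).
by apply/bigmax_leP; split=> // -[i j] _; rewrite (ord1 i).
Qed.

Lemma coord_le_norm n (v : 'rV[R]_n) i : `|v 0 i| <= `|v|.
Proof. by apply: (rV_normP v _).1. Qed.

Lemma cvg_rV n (T : Type) (F : set_system T) (FF : Filter F) (f : T -> 'rV[R]_n) (l : 'rV[R]_n) :
  (forall i, f t 0 i @[t --> F] --> l 0 i) -> f @ F --> l.
Proof.
move=> fl; apply/cvgrPdist_le => e e0.
have : \forall t \near F, forall i, `|l 0 i - f t 0 i| <= e.
  apply: filter_forall => i.
  exact: ((@cvgrPdist_le _ _ _ _ FF _ _).1 (fl i)).
apply: filterS => t te; apply/rV_normP => [|i]; first exact: ltW.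
by rewrite !mxE.
Qed.

Lemma norm_mulmx_le n m (A : 'M[R]_(n, m)) :
  exists2 C, 0 < C & forall v : 'rV[R]_n, `|v *m A| <= C * `|v|.
Proof.
pose B := \sum_(ij : 'I_n * 'I_m) `|A ij.1 ij.2|.
have B0 : 0 <= B by apply: sumr_ge0.
exists (1 + B) => [|v]; first by rewrite ltr_pwDl.
apply/rV_normP => [|i]; first by rewrite mulr_ge0// addr_ge0.
rewrite mxE (le_trans (ler_norm_sum _ _ _))//.
apply: (@le_trans _ _ (B * `|v|)); last by rewrite ler_wpM2r// lerDr.
rewrite /B -(pair_bigA _ (fun k j => `|A k j|)) /= mulr_suml.
apply: ler_sum => k _; rewrite normrM mulrC ler_pM// ?coord_le_norm//.
by rewrite (bigD1 i)//= lerDl sumr_ge0.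
Qed.

(** As vectors are rows, [A] acts on the right and the chain rule multiplies
Jacobian matrices from left to right. *)
Definition hasjac n m (F : 'rV[R]_n -> 'rV[R]_m) x (A : 'M[R]_(n, m)) : Prop :=
  forall i, hasgrad (fun y => F y 0 i) x (col i A)^T.

Lemma dot_col n m (v : 'rV[R]_n) (A : 'M[R]_(n, m)) i :
  dot v (col i A)^T = (v *m A) 0 i.
Proof. by rewrite mxE; apply: eq_bigr => k _; rewrite !mxE. Qed.

Lemma hasjacP n m (F : 'rV[R]_n -> 'rV[R]_m) x (A : 'M[R]_(n, m)) :
  hasjac F x A <-> forall e, 0 < e ->
    \forall v \near (0 : 'rV[R]_n), `|F (v + x) - F x - v *m A| <= e * `|v|.
Proof.
split=> FA => [e e0|i].
  have : \forall v \near (0 : 'rV[R]_n), forall i,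
      `|F (v + x) 0 i - F x 0 i - dot v (col i A)^T| <= e * `|v|.
    apply: (@filter_forall _ _ (fun i (v : 'rV[R]_n) =>
      `|F (v + x) 0 i - F x 0 i - dot v (col i A)^T| <= e * `|v|)
      (nbhs (0 : 'rV[R]_n)) (nbhs_filter _)) => i.
    exact: ((hasgradP _ _ _).1 (FA i) e e0).
  apply: filterS => v ve; apply/rV_normP => [|i]; first by rewrite mulr_ge0// ltW.
  by have := ve i; rewrite dot_col !mxE.
apply/hasgradP => e e0; have := FA e e0; apply: filterS => v.
by apply: le_trans; have := coord_le_norm (F (v + x) - F x - v *m A) i;
  rewrite !mxE dot_col mxE.
Qed.

Lemma hasjac_is_diff n m (F : 'rV[R]_n -> 'rV[R]_m) x (A : 'M[R]_(n, m)) :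
  hasjac F x A -> is_diff x F (mulmxr A).
Proof.
move=> /hasjacP FA.
have E : F \o shift x = cst (F x) + (mulmxr A : 'rV[R]_n -> 'rV[R]_m)
    +o_ (0 : 'rV[R]_n) id.
  apply/eqaddoP => e e0; have := FA e e0; apply: filterS => v.
  by rewrite -[X in _ -> `|X| <= _]/(F (v + x) - (F x + v *m A)) opprD addrA.
have dc : continuous (mulmxr A : 'rV[R]_n -> 'rV[R]_m).
  move=> v; apply: (@cvg_rV _ _ (nbhs v) (nbhs_filter v)) => i /=.
  rewrite -dot_col; under eq_fun do rewrite -dot_col; exact: dot_continuous.
have D := diff_unique dc E.
by apply: DiffDef; [apply/diff_locallyP; rewrite D|rewrite D].
Qed.

Lemma hasjac_jacobian n m (F : 'rV[R]_n -> 'rV[R]_m) x (A : 'M[R]_(n, m)) :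
  hasjac F x A -> 'J F x = A.
Proof.
move=> /hasjac_is_diff FA; rewrite /jacobian; apply/row_matrixP => i.
by rewrite !rowE mul_rV_lin1 diff_val.
Qed.

Lemma hasjac_continuous n m (F : 'rV[R]_n -> 'rV[R]_m) x (A : 'M[R]_(n, m)) :
  hasjac F x A -> {for x, continuous F}.
Proof.
move=> FA; apply: (@cvg_rV _ _ (nbhs x) (nbhs_filter x)) => i.
exact: (hasgrad_continuous (FA i)).
Qed.

Lemma hasjac_near n m (F G : 'rV[R]_n -> 'rV[R]_m) x (A : 'M[R]_(n, m)) :
  (\near x, F x = G x) -> hasjac F x A -> hasjac G x A.
Proof.
move=> FG FA i; apply: hasgrad_near (FA i).
by apply: filterS FG => y ->.
Qed.

Lemma hasgrad_comp n m (F : 'rV[R]_n -> 'rV[R]_m) (g : 'rV[R]_m -> R) x A d :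
  hasjac F x A -> hasgrad g (F x) d -> hasgrad (fun y => g (F y)) x (d *m A^T).
Proof.
move=> /hasjac_is_diff FA /hasgrad_is_diff gd; apply/hasgrad_is_diff.
have := @is_diff_comp _ _ _ _ F _ g _ x FA gd.
rewrite -[g \o F]/(fun y => g (F y)) => h.
by apply: is_diff_eq; apply/funext => v /=; rewrite !dotE trmx_mul trmxK mulmxA.
Qed.

Lemma hasjac_comp n m p (F : 'rV[R]_n -> 'rV[R]_m) (G : 'rV[R]_m -> 'rV[R]_p) x A B :
  hasjac F x A -> hasjac G (F x) B -> hasjac (fun y => G (F y)) x (A *m B).
Proof.
move=> FA GB i; have := hasgrad_comp FA (GB i).
by rewrite -trmx_mul !colE mulmxA.
Qed.

Lemma hasjacD n m (F G : 'rV[R]_n -> 'rV[R]_m) x A B :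
  hasjac F x A -> hasjac G x B -> hasjac (fun y => F y + G y) x (A + B).
Proof.
move=> FA GB i; under eq_fun do rewrite mxE.
by have := hasgradD (FA i) (GB i); rewrite -!raddfD.
Qed.

Lemma hasjacN n m (F : 'rV[R]_n -> 'rV[R]_m) x A :
  hasjac F x A -> hasjac (fun y => - F y) x (- A).
Proof.
move=> FA i; under eq_fun do rewrite mxE.
by have := hasgradN (FA i); rewrite -!raddfN.
Qed.

Lemma hasjacM n m (f : 'rV[R]_n -> R) (F : 'rV[R]_n -> 'rV[R]_m) x d A :
  hasgrad f x d -> hasjac F x A ->
  hasjac (fun y => f y *: F y) x (d^T *m F x + f x *: A).
Proof.
move=> fd FA i; under eq_fun do rewrite mxE.
have := hasgradM fd (FA i); congr hasgrad; apply/rowP => k; rewrite !mxE big_ord1 !mxE addrC; congr (_ + _).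
by rewrite mulrC.
Qed.

Lemma hasjac_cst n m (w : 'rV[R]_m) (x : 'rV[R]_n) : hasjac (fun=> w) x 0.
Proof.
move=> i; rewrite (_ : (col i 0)^T = 0); first exact: hasgrad_cst.
by apply/rowP => j; rewrite !mxE.
Qed.

Lemma hasjac_id n (x : 'rV[R]_n) : hasjac (fun y => y) x 1%:M.
Proof.
move=> i; have := hasgrad_coord i x; congr hasgrad; apply/rowP => k.
by rewrite !mxE eqxx eq_sym.
Qed.

Lemma hasgrad_dot n m (F G : 'rV[R]_n -> 'rV[R]_m) x A B :
  hasjac F x A -> hasjac G x B ->
  hasgrad (fun y => dot (F y) (G y)) x (F x *m B^T + G x *m A^T).
Proof.
move=> FA GB; rewrite /dot.
have := hasgrad_sum (index_enum _) (fun i => hasgradM (FA i) (GB i)).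
congr hasgrad; apply/rowP => k; rewrite summxE !mxE -big_split.
by apply: eq_bigr => i _; rewrite !mxE.
Qed.

(** Only continuity of the inverse is assumed: it makes the increments of the
inverse and of its argument comparable. *)
Lemma hasjac_inverse n (F G : 'rV[R]_n -> 'rV[R]_n) a A K :
  hasjac F a A -> A *m K = 1%:M -> G (F a) = a ->
  {for F a, continuous G} -> (\forall y \near F a, F (G y) = y) ->
  hasjac G (F a) K.
Proof.
move=> FA AK Ga Gc FG; apply/hasjacP => e e0.
have [C C0 CK] := norm_mulmx_le K.
pose d := Num.min (e / (2 * C ^+ 2)) (1 / (2 * C)).
have d0 : 0 < d.
  by rewrite lt_min !divr_gt0// ?mulr_gt0// exprn_gt0.
have FAd := (hasjacP _ _ _).1 FA d d0.
have shiftN (P : set 'rV[R]_n) (b : 'rV[R]_n) : (\forall y \near b, P y) ->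
    \forall v \near (0 : 'rV[R]_n), P (v + b).
  by rewrite (near_shift 0) /=; apply: filterS => v; rewrite subr0.
have Gc0 : (fun w => G (w + F a) - a) @ (0 : 'rV[R]_n) --> (0 : 'rV[R]_n).
  apply: ((@cvgrPdist_lt _ _ _ (nbhs (0 : 'rV[R]_n)) (nbhs_filter _) _ _).2).
  move=> eps eps0; have : \forall y \near F a, `|a - G y| < eps.
    by move/cvgrPdist_lt : Gc => /(_ _ eps0); rewrite Ga.
  by move=> /(shiftN _ _); apply: filterS => w; rewrite sub0r opprB.
have H1 := Gc0 _ FAd.
have H2 := shiftN _ _ FG.
near=> w.
have H2w : F (G (w + F a)) = w + F a by near: w.
have : `|F (G (w + F a) - a + a) - F a - (G (w + F a) - a) *m A| <=
    d * `|G (w + F a) - a| by near: w; exact: H1.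
rewrite subrK H2w addrK Ga; set k := G (w + F a) - a => h1.
have kK : k = k *m A *m K by rewrite -mulmxA AK mulmx1.
have h2 : `|k - w *m K| <= C * (d * `|k|).
  rewrite {1}kK -mulmxBl (le_trans (CK _))// ler_wpM2l ?(ltW C0)//.
  by rewrite -normrN opprB.
have Cd : C * d <= 1 / 2.
  apply: (@le_trans _ _ (C * (1 / (2 * C)))).
    by rewrite ler_wpM2l ?(ltW C0)// ge_min lexx orbT.
  by rewrite invfM !mul1r mulrCA mulfV ?mulr1 ?gt_eqF.
have h3 : `|k| <= 2 * (C * `|w|).
  have : `|k| <= `|k - w *m K| + `|w *m K|.
    by rewrite -{1}(subrK (w *m K) k) ler_normD.
  have := CK w; have : C * d * `|k| <= 1 / 2 * `|k| by rewrite ler_wpM2r.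
  rewrite mulrA in h2; lra.
apply: (le_trans h2).
apply: (@le_trans _ _ (C * (e / (2 * C ^+ 2) * (2 * (C * `|w|))))).
  rewrite ler_wpM2l ?(ltW C0)// ler_pM// ?(ltW d0)//.
  by rewrite ge_min lexx.
by rewrite le_eqVlt; apply/orP; left; apply/eqP; field; rewrite gt_eqF.
Unshelve. all: by end_near. Qed.

Lemma is_derive_line n (f : 'rV[R]_n -> R) (y v : 'rV[R]_n) (t : R) :
  derivable f (t *: v + y) v ->
  is_derive t 1 (fun s : R => f (s *: v + y)) ('D_v f (t *: v + y)).
Proof.
have E : (fun h : R => h^-1 *: (((fun s : R => f (s *: v + y))
    \o shift t) (h *: (1 : R)) - f (t *: v + y)))
  = (fun h : R => h^-1 *: ((f \o shift (t *: v + y)) (h *: v) - f (t *: v + y))).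
  apply/funext => h /=; congr (_ *: (f _ - _)).
  by rewrite addrA -scalerDl [_ *: 1]mulr1.
move=> df; apply: DeriveDef.
  by rewrite /derivable E.
by rewrite /derive E.
Qed.

(** The increment is telescoped along the coordinates, and the mean value
theorem is applied to each step. *)
Lemma C1_hasgrad n (f : 'rV[R]_n -> R) x :
  (\forall y \near x, forall i, derivable f y (delta_mx 0 i)) ->
  (forall i, {for x, continuous (fun y => 'D_(delta_mx 0 i) f y)}) ->
  hasgrad f x (\row_i 'D_(delta_mx 0 i) f x).
Proof.
move=> fdv fc; apply/hasgradP => e e0.
pose c := e / n.+1%:R.
have c0 : 0 < c by rewrite divr_gt0.
have : \forall y \near x, forall i, derivable f y (delta_mx 0 i) /\
    `|'D_(delta_mx 0 i) f y - 'D_(delta_mx 0 i) f x| <= c.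
  have : \forall y \near x, forall i,
      `|'D_(delta_mx 0 i) f y - 'D_(delta_mx 0 i) f x| <= c.
    apply: (@filter_forall _ _ (fun i (y : 'rV[R]_n) =>
      `|'D_(delta_mx 0 i) f y - 'D_(delta_mx 0 i) f x| <= c)
      (nbhs x) (nbhs_filter _)) => i.
    have /cvgrPdist_le /(_ c c0) := fc i.
    by apply: filterS => y; rewrite distrC.
  by apply: filterS2 fdv => y h1 h2 i; split.
move=> /nbhs_ballP[r /= r0 rP].
have Hr : \forall v \near (0 : 'rV[R]_n), `|v| < r.
  by apply/nbhs_ballP; exists r => // v; rewrite -ball_normE /= sub0r normrN.
apply: filterS Hr => v vr.
(* [z k] has moved the first [k] coordinates: it joins [x] to [v + x]. *)
pose z k : 'rV[R]_n := \row_i (x 0 i + if (i < k)%N then v 0 i else 0).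
have z0 : z 0%N = x by apply/rowP => i; rewrite mxE addr0.
have zn : z n = v + x by apply/rowP => i; rewrite !mxE ltn_ord addrC.
have inball k (t : R) (i : 'I_n) : 0 <= t <= 1 -> nat_of_ord i = k ->
    ball x r (z k + (t * v 0 i) *: delta_mx 0 i).
  move=> t01 ik; rewrite -ball_normE /=; apply: le_lt_trans vr.
  apply/rV_normP => // j; rewrite !mxE eqxx /=.
  rewrite opprD addrA opprD addrA subrr sub0r -opprD normrN -ik.
  have [ji|ij|ji] := ltngtP j i.
  - by rewrite -val_eqE /= ltn_eqF// mulr0 addr0 coord_le_norm.
  - by rewrite -val_eqE /= gtn_eqF// mulr0 addr0 normr0.
  - have -> : (j == i) by rewrite -val_eqE /= ji.
    rewrite mulr1 add0r normrM (le_trans _ (coord_le_norm v i))//.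
    by rewrite ler_piMl// ger0_norm; case/andP: t01.
have step (i : 'I_n) : `|f (z i.+1) - f (z i) - v 0 i * 'D_(delta_mx 0 i) f x|
    <= c * `|v|.
  pose phi (t : R) := f (z i + (t * v 0 i) *: delta_mx 0 i).
  have phi1 : phi 1 = f (z i.+1).
    congr f; apply/rowP => j; rewrite !mxE eqxx /= mul1r ltnS -addrA; congr (_ + _).
    have [ji|ij|ji] := ltngtP j i.
    - by rewrite -val_eqE /= ltn_eqF// mulr0 addr0.
    - by rewrite -val_eqE /= gtn_eqF// mulr0 addr0.
    - have -> : (j == i) by rewrite -val_eqE /= ji.
      have -> : j = i by exact: val_inj.
      by rewrite mulr1 add0r.
  have phi0 : phi 0 = f (z i) by rewrite /phi mul0r scale0r addr0.
  have dphi (t : R) : 0 <= t <= 1 -> is_derive t 1 phi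
      (v 0 i * 'D_(delta_mx 0 i) f (z i + (t * v 0 i) *: delta_mx 0 i)).
    move=> t01; have hb := inball _ t i t01 erefl.
    have [df _] := rP _ hb i.
    have dg : is_derive (t * v 0 i) 1
        (fun s : R => f (s *: delta_mx 0 i + z i))
        ('D_(delta_mx 0 i) f (z i + (t * v 0 i) *: delta_mx 0 i)).
      by rewrite addrC; apply: is_derive_line; rewrite addrC.
    have dl : is_derive t 1 (fun s : R => s * v 0 i) (v 0 i).
      have := @is_deriveM _ _ (fun s : R => s) (fun=> v 0 i) t 1 _ _
        (is_derive_id t 1) (is_derive_cst (v 0 i) t 1).
      by rewrite scaler0 add0r [_ *: _]mulr1.
    have dc := (derivable1_diffP _ _).1 (@ex_derive _ _ _ _ _ _ _ dg).
    have dd := (derivable1_diffP _ _).1 (@ex_derive _ _ _ _ _ _ _ dl).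
    have pE : phi = (fun s : R => f (s *: delta_mx 0 i + z i)) \o (fun s : R => s * v 0 i).
      by apply/funext => s; rewrite /phi /= addrC.
    rewrite pE; apply: DeriveDef.
      exact/derivable1_diffP/differentiable_comp.
    rewrite -derive1E derive1_comp; last 2 first.
    - exact: (@ex_derive _ _ _ _ _ _ _ dl).
    - exact: (@ex_derive _ _ _ _ _ _ _ dg).
    by rewrite !derive1E (derive_val (is_derive:=dg)) (derive_val (is_derive:=dl)) mulrC.
  have phic : {within `[0, 1], continuous phi}.
    apply: continuous_in_subspaceT => t; rewrite inE /= in_itv /= => t01.
    apply: differentiable_continuous; apply/derivable1_diffP.
    exact: (@ex_derive _ _ _ _ _ _ _ (dphi t t01)).
  have [t t01] := MVT ltr01 (fun t ht => dphi t (subset_itv_oo_cc ht)) phic.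
  rewrite phi1 phi0 subr0 mulr1 => ->.
  rewrite -mulrBr normrM mulrC ler_pM// ?coord_le_norm//.
  have t01' : 0 <= t <= 1 by have := subset_itv_oo_cc t01; rewrite in_itv.
  have hb := inball _ t i t01' erefl.
  by have [_] := rP _ hb i.
have -> : f (v + x) - f x = \sum_(i < n) (f (z i.+1) - f (z i)).
  by rewrite -zn -z0 -(telescope_sumr (fun k => f (z k)) (leq0n n)) big_mkord.
rewrite /dot -sumrB (le_trans (ler_norm_sum _ _ _))//.
apply: (@le_trans _ _ (\sum_(i < n) c * `|v|)).
  by apply: ler_sum => i _; rewrite mxE.
rewrite sumr_const card_ord -mulr_natr mulrAC ler_wpM2r// /c -mulrA.
rewrite ler_piMr ?(ltW e0)// mulrC ler_pdivrMr// mul1r ler_nat.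
exact: leqnSn.
Qed.

End Jacobian.

(** * Symmetry of the Hessian *)

Section Schwarz.
Context {R : realType} {n : nat}.
Implicit Types (x v d : 'rV[R]_n) (f g : 'rV[R]_n -> R).

Let second_difference f x (t : R) (i j : 'I_n) : R :=
  f (t *: delta_mx 0 i + (t *: delta_mx 0 j + x)) - f (t *: delta_mx 0 i + x)
  - (f (t *: delta_mx 0 j + x) - f x).

Let second_differenceC f x t i j :
  second_difference f x t i j = second_difference f x t j i.
Proof.
rewrite /second_difference (addrCA (t *: delta_mx 0 i)).
by set a := f _; set b := f _; set c := f _; set d := f x; ring.
Qed.

Lemma norm_scale_delta (t : R) (i : 'I_n) :
  `|t *: (delta_mx 0 i : 'rV[R]_n)| <= `|t|.
Proof.
apply/rV_normP => // j; rewrite !mxE eqxx /=.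
by case: eqP => _; rewrite ?mulr1// mulr0 normr0.
Qed.

(** The mean value theorem in the direction [i] is applied to the increment of [f]
in the direction [j]; the partial derivative that comes out is expanded to
first order at [x]. *)
Let second_difference_approx f x i d : (\forall y \near x, derivable f y (delta_mx 0 i)) ->
  hasgrad ('D_(delta_mx 0 i) f) x d ->
  forall e, 0 < e -> \forall t \near 0^'+, forall j,
    `|second_difference f x t i j - t ^+ 2 * d 0 j| <= 3 * e * t ^+ 2.
Proof.
move=> fi /hasgradP gd e e0.
have /nbhs_ballP[r1 /= r10 h1] := fi.
have /nbhs_ballP[r2 /= r20 h2] := gd e e0.
near=> t => j.
have t0 : 0 < t by near: t; exact: nbhs_right_gt.
have tr1 : t + t < r1.
  suff : t < r1 / 2 by lra.
  by near: t; apply: nbhs_right_lt; rewrite divr_gt0.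
have tr2 : t + t < r2.
  suff : t < r2 / 2 by lra.
  by near: t; apply: nbhs_right_lt; rewrite divr_gt0.
have small s (b : bool) : 0 <= s <= t ->
    `|s *: (delta_mx 0 i : 'rV[R]_n) + (b%:R * t) *: delta_mx 0 j| <= t + t.
  move=> /andP[s0 st]; rewrite (le_trans (ler_normD _ _))// lerD//.
    by rewrite (le_trans (norm_scale_delta _ _))// ger0_norm.
  rewrite (le_trans (norm_scale_delta _ _))//.
  by case: b; rewrite ?mul1r ?mul0r ?normr0 ?(ltW t0)// gtr0_norm.
have dline s (b : bool) : 0 <= s <= t ->
  derivable f (s *: delta_mx 0 i + ((b%:R * t) *: delta_mx 0 j + x)) (delta_mx 0 i).
  move=> st; apply: h1; rewrite -ball_normE /= addrA opprD addrCA subrr addr0.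
  by rewrite normrN (le_lt_trans (small s b st)).
pose phi s := f (s *: delta_mx 0 i + ((true%:R * t) *: delta_mx 0 j + x))
  - f (s *: delta_mx 0 i + ((false%:R * t) *: delta_mx 0 j + x)).
pose dphi s :=
   'D_(delta_mx 0 i) f (s *: delta_mx 0 i + ((true%:R * t) *: delta_mx 0 j + x))
  - 'D_(delta_mx 0 i) f (s *: delta_mx 0 i + ((false%:R * t) *: delta_mx 0 j + x)).
have pd s : 0 <= s <= t -> is_derive s 1 phi (dphi s).
  move=> st; apply: is_deriveB.
    exact: is_derive_line (dline s true st).
  exact: is_derive_line (dline s false st).
have phic : {within `[0, t], continuous phi}.
  apply: continuous_in_subspaceT => s; rewrite inE /= in_itv /= => st.
  apply: differentiable_continuous; apply/derivable1_diffP.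
  exact: (@ex_derive _ _ _ _ _ _ _ (pd s st)).
have [|s st] := MVT t0 (_ : forall s, s \in `]0, t[%R -> is_derive s 1 phi (dphi s)) phic.
  by move=> s /subset_itv_oo_cc; rewrite in_itv => /pd.
have {}st : 0 <= s <= t by have := subset_itv_oo_cc st; rewrite in_itv.
have -> : phi t - phi 0 = second_difference f x t i j.
  by rewrite /phi /second_difference mul1r mul0r !scale0r !add0r.
move=> ->; rewrite subr0.
have H (b : bool) := h2 (s *: delta_mx 0 i + (b%:R * t) *: delta_mx 0 j) .
have {}H (b : bool) : `|'D_(delta_mx 0 i) f (s *: delta_mx 0 i + ((b%:R * t) *: delta_mx 0 j + x))
   - 'D_(delta_mx 0 i) f x - (s * d 0 i + (b%:R * t) * d 0 j)| <= e * (t + b%:R * t).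
  apply: (@le_trans _ _ (e * `|s *: (delta_mx 0 i : 'rV[R]_n) + (b%:R * t) *: delta_mx 0 j|)).
    rewrite addrA -!dot_delta -!dotZl -dotDl; apply: H.
    by rewrite -ball_normE /= sub0r normrN (le_lt_trans (small s b st)).
  rewrite ler_wpM2l ?(ltW e0)// (le_trans (ler_normD _ _))// lerD//.
    by rewrite (le_trans (norm_scale_delta _ _))// ger0_norm; case/andP: st.
  rewrite (le_trans (norm_scale_delta _ _))//.
  by case: b {H}; rewrite ?mul1r ?mul0r ?normr0// gtr0_norm.
have := H true; have := H false; rewrite /dphi.
set A := 'D_ _ f _; set B := 'D_ _ f _; set C := 'D_ _ f _.
rewrite !mul0r !mul1r !addr0 => hA hC.
rewrite (_ : _ - _ = ((C - B - (s * d 0 i + t * d 0 j)) - (A - B - s * d 0 i)) * t);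
  last by rewrite expr2; ring.
rewrite normrM (gtr0_norm t0) expr2 mulrA ler_wpM2r ?(ltW t0)//.
by rewrite (le_trans (ler_normB _ _))// (le_trans (lerD hC hA))//; lra.
Unshelve. all: by end_near. Qed.

(** Both mixed derivatives are the limit of the same symmetric second
difference; differentiability of the first partials at the point is enough. *)
Lemma hessian_sym f x (D : 'I_n -> 'rV[R]_n) :
  (\forall y \near x, forall i, derivable f y (delta_mx 0 i)) ->
  (forall i, hasgrad ('D_(delta_mx 0 i) f) x (D i)) ->
  forall i j, D i 0 j = D j 0 i.
Proof.
move=> fd gd i j; apply/eqP; rewrite -subr_eq0 -normr_le0; apply/ler_addgt0Pr => e e0; rewrite add0r.
have H k : \forall y \near x, derivable f y (delta_mx 0 k).
  by apply: filterS fd.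
have e6 : 0 < e / 6 by rewrite divr_gt0.
have [t [t0 [hi hj]]] : exists t : R, 0 < t /\
    ((forall j', `|second_difference f x t i j' - t ^+ 2 * D i 0 j'| <= 3 * (e / 6) * t ^+ 2) /\
    (forall j', `|second_difference f x t j j' - t ^+ 2 * D j 0 j'| <= 3 * (e / 6) * t ^+ 2)).
  have h1 := second_difference_approx (H i) (gd i) e6.
  have h2 := second_difference_approx (H j) (gd j) e6.
  have h3 : \forall t \near 0^'+, 0 < t :> R by exact: nbhs_right_gt.
  by near (0 : R)^'+ => t; exists t; split; [near: t|split; near: t].
have := hi j; have := hj i; rewrite second_differenceC.
set S := second_difference _ _ _ _ _ => a1 a2.
rewrite -(@ler_pM2r _ (t ^+ 2)) ?exprn_gt0//.
rewrite -[X in _ * X]ger0_norm ?sqr_ge0// -normrM.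
rewrite (_ : _ * _ = (S - t ^+ 2 * D j 0 i) - (S - t ^+ 2 * D i 0 j)); last by ring.
rewrite (le_trans (ler_normB _ _))// (le_trans (lerD a1 a2))//.
by rewrite le_eqVlt; apply/orP; left; apply/eqP; field.
Unshelve. all: by end_near. Qed.

End Schwarz.

(** * Algebra of functions of class C^k *)

Section CkAlgebra.
Context {R : realType} {n : nat}.
Variable U : set 'rV[R]_n.
Hypothesis openU : open U.
Implicit Types (x v d : 'rV[R]_n) (f g : 'rV[R]_n -> R).

Let nearU x : U x -> \forall y \near x, U y.
Proof. by move=> Ux; exact: open_nbhs_nbhs. Qed.

Lemma Ck_continuous k f x : Ck k U f -> U x -> {for x, continuous f}.
Proof. by case: k => [|k] [fc _] Ux; exact: fc. Qed.

Lemma eq_Ck k f g : (forall x, U x -> f x = g x) -> Ck k U f -> Ck k U g.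
Proof.
have nfg (f' g' : 'rV[R]_n -> R) x : (forall x, U x -> f' x = g' x) -> U x ->
    \forall y \near x, f' y = g' y.
  by move=> fg Ux; apply: filterS (nearU Ux) => y; exact: fg.
have gc f' g' : (forall x, U x -> f' x = g' x) ->
    (forall x, U x -> {for x, continuous f'}) ->
    forall x, U x -> {for x, continuous g'}.
  move=> fg fc x Ux; rewrite /prop_for /continuous_at -fg//.
  apply: cvg_trans (fc x Ux).
  by apply: (@near_eq_cvg _ _ (nbhs x) (nbhs_filter x)); exact: nfg.
elim: k f g => [|k IH] f g fg [fc fk]; first by split=> //; exact: gc fc.
split; first exact: gc fc.
move=> i; have [fd fCk] := fk i; split=> [x Ux|].
  exact: near_eq_derivable (nfg _ _ _ fg Ux) (fd x Ux).
by apply: IH fCk => x Ux; apply: near_eq_derive; exact: nfg.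
Qed.

Lemma CkW k f : Ck k.+1 U f -> Ck k U f.
Proof.
elim: k f => [|k IH] f [fc fk]; split=> // i.
by have [fd fC] := fk i; split=> //; exact: IH.
Qed.

Lemma Ck_derivable k f x i : Ck k.+1 U f -> U x -> derivable f x (delta_mx 0 i).
Proof. by move=> [_ /(_ i)[fd _]]; exact: fd. Qed.

Lemma Ck_derive k f i : Ck k.+1 U f -> Ck k U ('D_(delta_mx 0 i) f).
Proof. by move=> [_ /(_ i)[_ ]]. Qed.

Lemma Ck_hasgrad k f x : Ck k.+1 U f -> U x ->
  hasgrad f x (\row_i 'D_(delta_mx 0 i) f x).
Proof.
move=> fC Ux; apply: C1_hasgrad.
  by apply: filterS (nearU Ux) => y Uy i; exact: Ck_derivable fC Uy.
by move=> i; exact: Ck_continuous (Ck_derive i fC) Ux.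
Qed.

(** A gradient field with [C^k] coordinates is the usual way to climb one order
of smoothness. *)
Lemma CkS_hasgrad k f (G : 'I_n -> 'rV[R]_n -> R) :
  (forall x, U x -> hasgrad f x (\row_i G i x)) ->
  (forall i, Ck k U (G i)) -> Ck k.+1 U f.
Proof.
move=> fG GC; split=> [x Ux|i].
  exact: hasgrad_continuous (fG x Ux).
have fd x : U x -> is_derive x (delta_mx 0 i) f (G i x).
  move=> Ux; have := hasgrad_derive (delta_mx 0 i) (fG x Ux).
  by rewrite dot_delta mxE.
split=> [x Ux|]; first by have [] := fd x Ux.
by apply: eq_Ck (GC i) => x Ux; have [_ ->] := fd x Ux.
Qed.

Lemma Ck_cst k (a : R) : Ck k U (fun=> a).
Proof.
elim: k a => [|k IH] a; first by split=> // x _; exact: cst_continuous.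
apply: (@CkS_hasgrad _ _ (fun=> fun=> 0)) => // x _.
rewrite (_ : (\row_i _) = 0); first exact: hasgrad_cst.
by apply/rowP => i; rewrite !mxE.
Qed.

Lemma Ck_D k f g : Ck k U f -> Ck k U g -> Ck k U (fun x => f x + g x).
Proof.
elim: k f g => [|k IH] f g fC gC.
  split=> // x Ux.
  by apply: continuousD; [exact: Ck_continuous fC Ux|exact: Ck_continuous gC Ux].
apply: (@CkS_hasgrad _ _ (fun i x => 'D_(delta_mx 0 i) f x + 'D_(delta_mx 0 i) g x)).
  move=> x Ux; have := hasgradD (Ck_hasgrad fC Ux) (Ck_hasgrad gC Ux).
  by congr hasgrad; apply/rowP => i; rewrite !mxE.
by move=> i; apply: IH; exact: Ck_derive.
Qed.

Lemma Ck_M k f g : Ck k U f -> Ck k U g -> Ck k U (fun x => f x * g x).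
Proof.
elim: k f g => [|k IH] f g fC gC.
  split=> // x Ux.
  by apply: continuousM; [exact: Ck_continuous fC Ux|exact: Ck_continuous gC Ux].
apply: (@CkS_hasgrad _ _ (fun i x =>
    f x * 'D_(delta_mx 0 i) g x + g x * 'D_(delta_mx 0 i) f x)).
  move=> x Ux; have := hasgradM (Ck_hasgrad fC Ux) (Ck_hasgrad gC Ux).
  by congr hasgrad; apply/rowP => i; rewrite !mxE.
by move=> i; apply: Ck_D; apply: IH; [exact: CkW|exact: Ck_derive|
  exact: CkW|exact: Ck_derive].
Qed.

Lemma Ck_V k f : (forall x, U x -> f x != 0) -> Ck k U f ->
  Ck k U (fun x => (f x)^-1).
Proof.
move=> f0; elim: k => [|k IH] fC.
  split=> // x Ux; apply: continuousV; first exact: f0.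
  exact: Ck_continuous fC Ux.
apply: (@CkS_hasgrad _ _ (fun i x =>
    (-1) * ((f x)^-1 * ((f x)^-1 * 'D_(delta_mx 0 i) f x)))).
  move=> x Ux; have := hasgradV (Ck_hasgrad fC Ux) (f0 x Ux).
  congr hasgrad; apply/rowP => i; rewrite !mxE.
  by rewrite -exprVn expr2 mulN1r mulNr mulrA.
move=> i; apply: Ck_M; first exact: Ck_cst.
have fV := IH (CkW fC).
by do 2 (apply: Ck_M => //); exact: Ck_derive.
Qed.

(** For a single function of one variable, the induction on [k] would need the
regularity of its derivative; for a family closed under derivation, in the sense
of the second hypothesis, it closes up. *)
Lemma Ck_comp_family k (phi dphi : nat -> R -> R) f :
  (forall m (t : R), is_derive t (1 : R) (phi m) (dphi m t)) ->
  (forall k m g, (forall m, Ck k U (fun x => phi m (g x))) ->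
     Ck k U (fun x => dphi m (g x))) ->
  Ck k U f -> forall m, Ck k U (fun x => phi m (f x)).
Proof.
move=> pd dC; elim: k f => [|k IH] f fC m.
  split=> // x Ux; apply: (@continuous_comp _ _ _ f (phi m)).
    exact: Ck_continuous fC Ux.
  apply: differentiable_continuous; apply/derivable1_diffP.
  by have [] := pd m (f x).
apply: (@CkS_hasgrad _ _ (fun i x => dphi m (f x) * 'D_(delta_mx 0 i) f x)).
  move=> x Ux; have := hasgrad_comp1 (Ck_hasgrad fC Ux) (pd m (f x)).
  by congr hasgrad; apply/rowP => i; rewrite !mxE.
move=> i; apply: Ck_M; last exact: Ck_derive.
by apply: dC => m'; apply: IH; exact: CkW.
Qed.

End CkAlgebra.

(** * A smooth truncation *)

Section FlatFunctions.
Context {R : realType}.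

(** All the powers of [t^-1] are included because derivation produces them, see
[flat_derive]: only the family is closed under derivation. *)
Definition flat (m : nat) (t : R) : R :=
  if 0 < t then t^-1 ^+ m * expR (- t^-1) else 0.

Lemma flat_ge0 m t : 0 <= flat m t.
Proof.
rewrite /flat; case: ifP => // t0.
by rewrite mulr_ge0 ?expR_ge0// exprn_ge0// invr_ge0 ltW.
Qed.

(** The exponential beats the power of degree [m.+1]. This linear bound, used for
[m.+1], is what makes [flat m] differentiable at 0. *)
Lemma flat_le m t : 0 < t -> flat m t <= m.+1%:R ^+ m.+1 * t.
Proof.
move=> t0; rewrite /flat t0 expRN ler_pdivrMr ?expR_gt0//.
have k0 : 0 < m.+1%:R :> R by [].
have : (t^-1 / m.+1%:R) ^+ m.+1 <= expR t^-1.
  rewrite -[X in expR X](@divfK _ m.+1%:R) ?gt_eqF// expRM_natr.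
  rewrite lerXn2r ?nnegrE ?expR_ge0// ?divr_ge0 ?invr_ge0 ?(ltW t0)//.
  by rewrite (le_trans _ (expR_ge1Dx _))// lerDr.
rewrite expr_div_n ler_pdivrMr ?exprn_gt0// => h.
rewrite (le_trans _ (_ : t * (expR t^-1 * m.+1%:R ^+ m.+1) <= _))//; last first.
  by rewrite le_eqVlt; apply/orP; left; apply/eqP; ring.
by rewrite -ler_pdivrMl// -exprS.
Qed.

Lemma flat_derive m (t : R) :
  is_derive t (1 : R) (flat m) (flat m.+2 t - m%:R * flat m.+1 t).
Proof.
have [t0|t0|t0] := ltgtP t 0.
- rewrite (_ : _ - _ = 0); last by rewrite /flat ltNge (ltW t0) /= mulr0 subr0.
  apply: (@near_eq_is_derive _ _ _ (fun=> 0)).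
    near=> s; rewrite /flat ltNge (_ : s <= 0)//.
    by apply/ltW; near: s; exact: lt_nbhsl.
- have tN0 : t != 0 by rewrite gt_eqF.
  apply: (@near_eq_is_derive _ _ _ (fun s : R => s^-1 ^+ m * expR (- s^-1))).
    near=> s; rewrite /flat (_ : 0 < s)//.
    by near: s; exact: lt_nbhsr.
  have iV : is_derive t (1 : R) (fun s : R => s^-1) (- t ^- 2).
    apply: DeriveDef; first by apply: derivableV => //; exact: derivable_id.
    by rewrite (@deriveV _ _ id)// derive_id /GRing.scale /= mulr1.
  have iX : is_derive t (1 : R) (fun s : R => s^-1 ^+ m) (m%:R * t^-1 ^+ m.-1 * (- t ^- 2)).
    have := @is_deriveX _ _ (fun s : R => s^-1) m t 1 _ iV.
    rewrite /GRing.scale /= -mulr_natl.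
    by rewrite (_ : _ ^+ m = (fun s : R => s^-1 ^+ m))//; apply/funext => s; rewrite fctE.
  have iE : is_derive t (1 : R) (fun s : R => expR (- s^-1)) (t ^- 2 * expR (- t^-1)).
    apply: is_derive_eq.
    by rewrite opprK mulrC.
  have := is_deriveM iX iE; rewrite /GRing.scale /= => h.
  apply: is_derive_eq; rewrite /flat t0.
  have -> : t ^- 2 = t^-1 ^+ 2 by rewrite exprVn.
  by case: m {h iX} => [|m] /=; rewrite ?exprS; ring.
- rewrite t0 (_ : _ - _ = 0); last by rewrite /flat ltxx mulr0 subr0.
  suff : (fun h => h^-1 *: ((flat m \o shift 0) (h *: (1 : R)) - flat m 0)) @ 0^' --> (0 : R).
    move=> h; apply: DeriveDef; first by apply/cvg_ex; exists 0.
    exact: cvg_lim h.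
  apply/cvgrPdist_le => e e0.
  near=> h.
  have h0 : h != 0 by near: h; exact: nbhs_dnbhs_neq.
  rewrite sub0r normrN /= addr0 [_ *: 1]mulr1 {2}/flat ltxx subr0.
  rewrite /flat; case: ifPn => [hp|_]; last by rewrite scaler0 normr0 ltW.
  rewrite [_ *: _]mulrA -exprS.
  rewrite (_ : _ * _ = flat m.+1 h); last by rewrite /flat hp.
  rewrite ger0_norm ?flat_ge0// (le_trans (flat_le _ hp))//.
  rewrite -ler_pdivlMl ?exprn_gt0//.
  suff : `|h| <= (m.+2%:R ^+ m.+2)^-1 * e by rewrite gtr0_norm.
  near: h; apply: dnbhs0_le.
  by rewrite mulr_gt0// invr_gt0 exprn_gt0.
Unshelve. all: by end_near. Qed.

Lemma Ck_flat n (U : set 'rV[R]_n) (openU : open U) k m (f : 'rV[R]_n -> R) :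
  Ck k U f -> Ck k U (fun x => flat m (f x)).
Proof.
move=> fC; apply: (Ck_comp_family openU _ _ fC); first exact: flat_derive.
move=> k' m' g gC; apply: Ck_D => //.
under eq_fun do rewrite -mulNr; apply: Ck_M => //; exact: Ck_cst.
Qed.

(** Since [s ^+ 2 * flat 2 s = flat 0 s], the derivative of [s / (1 + s * flat 0 s)]
is [(1 - flat 0 s) / (1 + s * flat 0 s) ^+ 2], which lies between 0 and 1. *)
Definition soft_cap (s : R) : R := s / (1 + s * flat 0 s).

Lemma flat0_le1 (s : R) : flat 0 s <= 1.
Proof.
rewrite /flat; case: ifP => // s0.
by rewrite expr0 mul1r expR_le1 oppr_le0 invr_ge0 ltW.
Qed.

Lemma soft_cap_den (s : R) : 1 <= 1 + s * flat 0 s.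
Proof.
rewrite lerDl; have [s0|s0] := ltP 0 s; first by rewrite mulr_ge0 ?flat_ge0// ltW.
by rewrite /flat ltNge s0 /= mulr0.
Qed.

Lemma soft_cap_den_gt0 (s : R) : 0 < 1 + s * flat 0 s.
Proof. exact: lt_le_trans (soft_cap_den s). Qed.

Lemma soft_cap_id (s : R) : s <= 0 -> soft_cap s = s.
Proof. by move=> s0; rewrite /soft_cap /flat ltNge s0 /= mulr0 addr0 divr1. Qed.

Lemma soft_cap_le1 (s : R) : soft_cap s <= 1.
Proof.
rewrite ler_pdivrMr ?soft_cap_den_gt0// mul1r.
have [s0|s0] := ltP 0 s; last first.
  by rewrite (le_trans s0)// ltW// soft_cap_den_gt0.
rewrite /flat s0 expr0 mul1r -lerBlDl.
rewrite (_ : s - 1 = s * (1 - s^-1)); last by rewrite mulrBr mulr1 divff// gt_eqF.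
by rewrite ler_wpM2l ?(ltW s0)// (le_trans _ (expR_ge1Dx _)).
Qed.

Lemma soft_cap_ge0 (s : R) : 0 <= s -> 0 <= soft_cap s.
Proof. by move=> s0; rewrite divr_ge0// ltW// soft_cap_den_gt0. Qed.

Lemma soft_cap_derive (s : R) : is_derive s (1 : R) soft_cap
  ((1 - flat 0 s) / (1 + s * flat 0 s) ^+ 2).
Proof.
have d0 : 1 + s * flat 0 s != 0 by rewrite gt_eqF// soft_cap_den_gt0.
have fd := flat_derive 0 s; rewrite mul0r subr0 in fd.
have dd : is_derive s (1 : R) (fun s : R => 1 + s * flat 0 s) (flat 0 s + s * flat 2 s).
  apply: is_derive_eq.
  by rewrite add0r mul1r /GRing.scale /= mulr1 addrC.
have dV : is_derive s (1 : R) (fun s : R => (1 + s * flat 0 s)^-1)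
    (- (1 + s * flat 0 s) ^- 2 * (flat 0 s + s * flat 2 s)).
  have [e1 e2] := dd.
  by apply: DeriveDef; [exact: derivableV|rewrite deriveV// e2].
rewrite /soft_cap; apply: is_derive_eq.
rewrite /GRing.scale /= mulr1.
have -> : s * flat 2 s = flat 0 s / s.
  rewrite /flat; case: ifP => [s0|_]; last by rewrite mulr0 mul0r.
  by rewrite expr0 mul1r expr2; field; rewrite gt_eqF.
have [s0|s0] := eqVneq s 0.
  by rewrite s0 !mul0r /flat ltxx !addr0 add0r subr0 expr1n invr1 mulr1.
by field; rewrite s0 d0.
Qed.

Lemma soft_cap_lip (s t : R) : s < t -> 0 <= soft_cap t - soft_cap s <= t - s.
Proof.
move=> st.
have [|c _ ->] := MVT st (fun x _ => soft_cap_derive x).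
  apply: continuous_subspaceT => x; apply: differentiable_continuous.
  by apply/derivable1_diffP; have [] := soft_cap_derive x.
have ts : 0 <= t - s by rewrite subr_ge0 ltW.
have := flat0_le1 c; have := flat_ge0 0 c; have := soft_cap_den c => h1 h2 h3.
have h4 : 0 < (1 + c * flat 0 c) ^+ 2 by rewrite exprn_gt0// soft_cap_den_gt0.
apply/andP; split; first by rewrite mulr_ge0// divr_ge0 ?(ltW h4)// subr_ge0.
rewrite ler_piMl// ler_pdivrMr// mul1r.
by rewrite (@le_trans _ _ 1)// ?expr_ge1 ?gerBl// (le_trans _ h1).
Qed.

(** The part of [t] above 1 is capped at height [e]; the part below 0 is treated
in the same way after a reflection. *)
Definition soft_clip (e t : R) : R :=
  let a := 1 + e * soft_cap ((t - 1) / e) in - (e * soft_cap (- a / e)).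

Section SoftClip.
Variable e : R.
Hypothesis e0 : 0 < e.

Let upper t : R := 1 + e * soft_cap ((t - 1) / e).
Let lower t : R := - (e * soft_cap (- t / e)).

Let upper_id t : t <= 1 -> upper t = t.
Proof.
move=> t1; rewrite /upper soft_cap_id; first by field; rewrite gt_eqF.
by rewrite pmulr_lle0 ?invr_gt0// subr_le0.
Qed.

Let lower_id t : 0 <= t -> lower t = t.
Proof.
move=> t1; rewrite /lower soft_cap_id; first by field; rewrite gt_eqF.
by rewrite pmulr_lle0 ?invr_gt0// oppr_le0.
Qed.

Let scale_lip (s t : R) : s <= t ->
  0 <= e * (soft_cap (t / e) - soft_cap (s / e)) <= t - s.
Proof.
rewrite le_eqVlt => /orP[/eqP->|st]; first by rewrite !subrr mulr0 lexx.
have /soft_cap_lip/andP[h1 h2] : s / e < t / e by rewrite ltr_pM2r ?invr_gt0.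
rewrite mulr_ge0 ?(ltW e0)//=.
by rewrite mulrC -ler_pdivlMr// mulrBl.
Qed.

Let upper_lip s t : s <= t -> 0 <= upper t - upper s <= t - s.
Proof.
move=> st; have /scale_lip : s - 1 <= t - 1 by rewrite lerD2r.
rewrite (_ : t - 1 - (s - 1) = t - s); last by ring.
by rewrite (_ : upper t - upper s = e * (soft_cap ((t - 1) / e) - soft_cap ((s - 1) / e))) // /upper; ring.
Qed.

Let lower_lip s t : s <= t -> 0 <= lower t - lower s <= t - s.
Proof.
move=> st; have /scale_lip : - t <= - s by rewrite lerN2.
rewrite (_ : - s - - t = t - s); last by ring.
by rewrite (_ : lower t - lower s = e * (soft_cap (- s / e) - soft_cap (- t / e))) // /lower; ring.
Qed.

Lemma soft_clip_id t : 0 <= t <= 1 -> soft_clip e t = t.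
Proof.
move=> /andP[t0 t1]; rewrite /soft_clip -/(upper t) upper_id//.
exact: lower_id.
Qed.

Lemma soft_clip_lip s t : s < t -> 0 <= soft_clip e t - soft_clip e s <= t - s.
Proof.
move=> /ltW st; have /andP[h1 h2] := upper_lip st.
have /lower_lip/andP[h3 h4] : upper s <= upper t by rewrite -subr_ge0.
by rewrite [soft_clip e t]/(lower (upper t)) h3 (le_trans h4).
Qed.

Lemma soft_clip_itv t : - e <= soft_clip e t <= 1 + e.
Proof.
rewrite [soft_clip e t]/(lower (upper t)); apply/andP; split.
  by rewrite lerN2 ler_piMr ?(ltW e0)// soft_cap_le1.
have u1 : upper t <= 1 + e by rewrite lerD2l ler_piMr ?(ltW e0)// soft_cap_le1.
have [t0|t0] := leP 0 (upper t).
  by apply: le_trans u1; rewrite -[X in X <= _]/(lower (upper t)) lower_id.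
rewrite (@le_trans _ _ 0)// ?addr_ge0 ?(ltW e0)// oppr_le0 mulr_ge0 ?(ltW e0)//.
by rewrite soft_cap_ge0// divr_ge0 ?(ltW e0)// oppr_ge0 ltW.
Qed.

Lemma soft_clip_derivable t : derivable (soft_clip e) t 1.
Proof.
have capd (g : R -> R) x : derivable g x 1 -> derivable (fun x => soft_cap (g x)) x 1.
  move=> /derivable1_diffP gd; apply/derivable1_diffP.
  apply: (@differentiable_comp _ _ _ _ g soft_cap) => //.
  by apply/derivable1_diffP; have [] := soft_cap_derive (g x).
have ud : derivable upper t 1.
  apply: derivableD; first exact: derivable_cst.
  apply: derivableM; first exact: derivable_cst.
  apply: capd; apply: derivableM; last exact: derivable_cst.
  by apply: derivableB; [exact: derivable_id|exact: derivable_cst].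
apply: derivableN; apply: derivableM; first exact: derivable_cst.
apply: capd; apply: derivableM; last exact: derivable_cst.
exact: derivableN.
Qed.

Lemma soft_clip_derive_itv t : 0 <= 'D_1 (soft_clip e) t <= 1.
Proof.
have dE : derivable (soft_clip e) t (1 : R) by exact: soft_clip_derivable.
have slope (h : R) : h != 0 ->
    0 <= h^-1 *: ((soft_clip e \o shift t) (h *: (1 : R)) - soft_clip e t) <= 1.
  move=> h0 /=; rewrite [_ *: 1]mulr1 [_ *: _]mulrC.
  have [hp|hn|] := ltgtP 0 h; last by move=> hE; rewrite -hE eqxx in h0.
    have /soft_clip_lip/andP[h1 h2] : t < h + t by rewrite ltrDr.
    rewrite divr_ge0 ?(ltW hp)//= ler_pdivrMr// mul1r.
    by rewrite addrK in h2.
  have /soft_clip_lip/andP[h1 h2] : h + t < t by rewrite gtrDr.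
  rewrite -[X in _ <= X <= _]mulrNN -invrN opprB.
  rewrite divr_ge0 ?oppr_ge0 ?(ltW hn)//= ler_pdivrMr ?oppr_gt0// mul1r.
  by rewrite (_ : - h = t - (h + t))//; ring.
apply/andP; split.
  apply: limr_ge => //; near=> h.
  have h0 : h != 0 by near: h; exact: nbhs_dnbhs_neq.
  by case/andP: (slope h h0).
apply: limr_le => //; near=> h.
have h0 : h != 0 by near: h; exact: nbhs_dnbhs_neq.
by case/andP: (slope h h0).
Unshelve. all: by end_near. Qed.

Lemma Ck_soft_clip n (U : set 'rV[R]_n) (openU : open U) k (f : 'rV[R]_n -> R) :
  Ck k U f -> Ck k U (fun x => soft_clip e (f x)).
Proof.
have capC g : Ck k U g -> Ck k U (fun x => soft_cap (g x)).
  move=> gC; apply: (Ck_M openU) => //; apply: (Ck_V openU) => // [x _|].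
    by rewrite gt_eqF// soft_cap_den_gt0.
  apply: (Ck_D openU); first exact: (Ck_cst openU).
  by apply: (Ck_M openU) => //; exact: (Ck_flat openU).
have NC g : Ck k U g -> Ck k U (fun x => - g x).
  move=> gC; under eq_fun do rewrite -mulN1r; apply: (Ck_M openU) => //; exact: (Ck_cst openU).
move=> fC; rewrite /soft_clip; apply: (NC _); apply: (Ck_M openU); first exact: (Ck_cst openU).
apply: (capC _); apply: (Ck_M openU); last exact: (Ck_cst openU).
apply: (NC _); apply: (Ck_D openU); first exact: (Ck_cst openU).
apply: (Ck_M openU); first exact: (Ck_cst openU).
apply: (capC _); apply: (Ck_M openU); last exact: (Ck_cst openU).
by apply: (Ck_D openU) => //; exact: (Ck_cst openU).
Qed.

End SoftClip.
End FlatFunctions.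

(** * Geometry of the sphere *)

Section Sphere.
Context {R : realType} {n : nat}.
Implicit Types (x y v d z : 'rV[R]_n) (f g h u : 'rV[R]_n -> R).

Lemma enorm_sqr x : enorm x ^+ 2 = dot x x.
Proof. by rewrite sqr_sqrtr ?dot_ge0. Qed.

Lemma enorm_ge0 x : 0 <= enorm x. Proof. exact: sqrtr_ge0. Qed.

Lemma enorm_eq0 x : (enorm x == 0) = (x == 0).
Proof. by rewrite -dot_eq0 -enorm_sqr sqrf_eq0. Qed.

Lemma enorm_gt0 x : (0 < enorm x) = (x != 0).
Proof. by rewrite lt_neqAle enorm_ge0 andbT eq_sym enorm_eq0. Qed.

Lemma enormZ (a : R) x : 0 <= a -> enorm (a *: x) = a * enorm x.
Proof.
move=> a0; rewrite /enorm dotZl dotZr mulrA -expr2 sqrtrM ?sqr_ge0//.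
by rewrite sqrtr_sqr ger0_norm.
Qed.

Lemma enorm_sphere x : sphere x -> enorm x = 1.
Proof. by rewrite /enorm => ->; rewrite sqrtr1. Qed.

Lemma sphere_neq0 x : sphere x -> x != 0.
Proof. by move=> Sx; rewrite -dot_eq0 Sx oner_neq0. Qed.

Lemma sphere_normalize x : x != 0 -> sphere (normalize x).
Proof.
move=> x0; rewrite /sphere /= dotZl dotZr -enorm_sqr.
by field; rewrite enorm_eq0.
Qed.

Lemma normalize_sphere x : sphere x -> normalize x = x.
Proof. by move=> Sx; rewrite /normalize enorm_sphere// invr1 scale1r. Qed.

Lemma normalizeZ (a : R) x : 0 < a -> normalize (a *: x) = normalize x.
Proof.
move=> a0; rewrite /normalize enormZ ?(ltW a0)// scalerA invfM.
by rewrite mulrAC mulVf ?mul1r// gt_eqF.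
Qed.

Lemma enorm_normalize x : enorm x *: normalize x = x.
Proof.
have [->|x0] := eqVneq x 0; first by rewrite /normalize !scaler0.
by rewrite scalerA mulfV ?scale1r// enorm_eq0.
Qed.

Lemma open_neq0 : open [set x : 'rV[R]_n | x != 0].
Proof.
rewrite (_ : [set x | _] = ~` [set 0]).
  exact/closed_openC/accessible_closed_set1/hausdorff_accessible/norm_hausdorff.
by apply/seteqP; split => x /= /eqP.
Qed.

Lemma near_neq0 x : x != 0 -> \forall y \near x, y != 0.
Proof. by move=> x0; exact: (open_nbhs_nbhs (conj open_neq0 x0)). Qed.

Lemma hasgrad_enorm x : x != 0 -> hasgrad enorm x (normalize x).
Proof.
move=> x0; have d0 := dot_gt0 x0.
have := hasgrad_comp1 (hasgrad_dot (hasjac_id x) (hasjac_id x)) (is_derive1_sqrt d0).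
rewrite !trmx1 !mulmx1 (_ : x + x = 2 *: x); last by rewrite scaler_nat mulr2n.
rewrite scalerA; congr hasgrad.
rewrite /normalize /enorm; congr (_ *: _).
by rewrite invfM mulrAC mulVf ?mul1r.
Qed.

Lemma hasjac_normalize x : x != 0 ->
  hasjac normalize x ((enorm x)^-1 *: tproj (normalize x)).
Proof.
move=> x0; have e0 : enorm x != 0 by rewrite enorm_eq0.
have := hasjacM (hasgradV (hasgrad_enorm x0) e0) (hasjac_id x).
congr hasjac; rewrite /tproj scalerBr addrC; congr (_ + _).
rewrite linearZ /= -scalemxAl scaleNr; congr (- _).
rewrite -[X in _ *m X](enorm_normalize x) -scalemxAr scalerA; congr (_ *: _).
by field.
Qed.

Lemma hasjac_normalize_sphere x : sphere x -> hasjac normalize x (tproj x).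
Proof.
move=> Sx; have := hasjac_normalize (sphere_neq0 Sx).
by rewrite enorm_sphere// invr1 scale1r normalize_sphere.
Qed.

Lemma tproj_tr x : (tproj x)^T = tproj x.
Proof. by rewrite /tproj linearB /= trmx1 trmx_mul trmxK. Qed.

Lemma mul_tproj v x : v *m tproj x = v - dot v x *: x.
Proof. by rewrite /tproj mulmxBr mulmx1 mulmxA mulmx_tr_dot mul_scalar_mx. Qed.

Lemma mul_tproj_id v x : dot x v = 0 -> v *m tproj x = v.
Proof. by move=> vx; rewrite mul_tproj dotC vx scale0r subr0. Qed.

Lemma mul_tproj0 x : sphere x -> x *m tproj x = 0.
Proof. by move=> Sx; rewrite mul_tproj Sx scale1r subrr. Qed.

Lemma tproj_mulT0 x : sphere x -> tproj x *m x^T = 0.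
Proof. by move=> /mul_tproj0/(congr1 trmx); rewrite trmx_mul tproj_tr trmx0. Qed.

Lemma tproj_idem x : sphere x -> tproj x *m tproj x = tproj x.
Proof.
by move=> Sx; rewrite {2}/tproj mulmxBr mulmx1 mulmxA tproj_mulT0// mul0mx subr0.
Qed.

Lemma dot_mul_tproj v x : sphere x -> dot x (v *m tproj x) = 0.
Proof. by move=> Sx; rewrite mul_tproj dotDr dotNr dotZr Sx mulr1 dotC subrr. Qed.

(** A 0-homogeneous function is constant along the ray through [x]. *)
Lemma hasgrad_hat_radial f x d : x != 0 -> hasgrad (f \o normalize) x d -> dot x d = 0.
Proof.
move=> x0 fd.
have l : is_derive (0 : R) (1 : R) (fun s => (f \o normalize) (s *: x + x)) (dot x d).
  have [dh dE] := hasgrad_derive x fd.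
  by have := @is_derive_line _ _ (f \o normalize) x x 0; rewrite scale0r add0r dE => /(_ dh).
have l' : is_derive (0 : R) (1 : R) (fun s => (f \o normalize) (s *: x + x)) 0.
  apply: (@near_eq_is_derive _ _ _ (fun=> (f \o normalize) x)).
  near=> s; rewrite /= (_ : s *: x + x = (s + 1) *: x); last by rewrite scalerDl scale1r.
  rewrite normalizeZ//.
  rewrite -ltrBlDr sub0r.
  by near: s; apply: lt_nbhsr; rewrite ltrN10.
have [_ e1] := l; have [_ e2] := l'; exact: etrans (esym e1) e2.
Unshelve. all: by end_near. Qed.

Lemma hasjac_hat_radial m (F : 'rV[R]_n -> 'rV[R]_m) x A : x != 0 ->
  hasjac (F \o normalize) x A -> x *m A = 0.
Proof.
move=> x0 FA; apply/rowP => i; rewrite -dot_col [RHS]mxE.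
exact: (@hasgrad_hat_radial (fun y => F y 0 i)) (FA i).
Qed.

Lemma hasgrad_hat_scale f x d (a : R) : 0 < a -> hasgrad (f \o normalize) x d ->
  hasgrad (f \o normalize) (a *: x) (a^-1 *: d).
Proof.
move=> a0 fd; have aN0 : a != 0 by rewrite gt_eqF.
have J := hasjacM (hasgrad_cst a^-1 (a *: x)) (hasjac_id (a *: x)).
have := @hasgrad_comp _ _ _ (fun y => a^-1 *: y) (f \o normalize) (a *: x) _ d J.
rewrite scalerA mulVf// scale1r => /(_ fd).
rewrite trmx0 mul0mx add0r linearZ /= trmx1 -scalemxAr mulmx1.
apply: hasgrad_near; near=> y; rewrite /= normalizeZ// invr_gt0//.
Unshelve. all: by end_near. Qed.

End Sphere.

(** * Smooth functions on the sphere *)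

Section SmoothFunctions.
Context {R : realType} {n : nat}.
Implicit Types (x y v d z : 'rV[R]_n) (f g h u : 'rV[R]_n -> R).

Lemma eq_smooth f g : (forall x, sphere x -> f x = g x) -> smooth f -> smooth g.
Proof.
move=> fg fs k; apply: (eq_Ck open_neq0) (fs k) => x x0 /=.
exact: fg (sphere_normalize x0).
Qed.

Lemma smooth_cst (a : R) : smooth (fun _ : 'rV[R]_n => a).
Proof. by move=> k; exact: (Ck_cst open_neq0). Qed.

Lemma smoothD f g : smooth f -> smooth g -> smooth (fun x => f x + g x).
Proof. by move=> fs gs k; exact: (Ck_D open_neq0 (fs k) (gs k)). Qed.

Lemma smoothM f g : smooth f -> smooth g -> smooth (fun x => f x * g x).
Proof. by move=> fs gs k; exact: (Ck_M open_neq0 (fs k) (gs k)). Qed.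

Lemma smoothV f : (forall x, sphere x -> f x != 0) -> smooth f ->
  smooth (fun x => (f x)^-1).
Proof.
move=> f0 fs k; apply: (@Ck_V _ _ _ open_neq0 _ (f \o normalize) _ (fs k)) => x x0.
exact: f0 (sphere_normalize x0).
Qed.

Lemma smooth_soft_clip (e : R) f : smooth f -> smooth (soft_clip e \o f).
Proof. by move=> fs k; exact: (Ck_soft_clip e open_neq0 (fs k)). Qed.

Lemma smooth_hasgrad f x : smooth f -> x != 0 ->
  hasgrad (f \o normalize) x (sgrad f x).
Proof. by move=> fs x0; exact: (Ck_hasgrad open_neq0 (fs 1%N) x0). Qed.

Lemma sgrad_hasgrad f x d : hasgrad (f \o normalize) x d -> sgrad f x = d.
Proof. by move=> /hasgrad_grad ->. Qed.

Lemma sgrad_radial f x : smooth f -> x != 0 -> dot x (sgrad f x) = 0.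
Proof. by move=> fs x0; apply: (hasgrad_hat_radial x0); exact: smooth_hasgrad. Qed.

Lemma sgrad_tproj f x : smooth f -> sphere x -> sgrad f x *m tproj x = sgrad f x.
Proof. by move=> fs Sx; rewrite mul_tproj_id// sgrad_radial// sphere_neq0. Qed.

Lemma sgrad_normalize f x : smooth f -> x != 0 ->
  sgrad f (normalize x) = enorm x *: sgrad f x.
Proof.
move=> fs x0; have e0 : 0 < (enorm x)^-1 by rewrite invr_gt0 enorm_gt0.
have := hasgrad_hat_scale e0 (smooth_hasgrad fs x0).
by rewrite invrK => /sgrad_hasgrad.
Qed.

Definition hat_hessian f x : 'M[R]_n :=
  \matrix_(k, i) 'D_(delta_mx 0 k) ('D_(delta_mx 0 i) (f \o normalize)) x.

Lemma hasjac_sgrad_ambient f x : smooth f -> x != 0 ->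
  hasjac (sgrad f) x (hat_hessian f x).
Proof.
move=> fs x0 i; have := Ck_hasgrad open_neq0 (Ck_derive i (fs 2%N)) x0.
rewrite (_ : (\row_j _) = (col i (hat_hessian f x))^T).
  by apply: hasgrad_near; near=> y; rewrite mxE.
by apply/rowP => k; rewrite !mxE.
Unshelve. all: by end_near. Qed.

Lemma hat_hessian_sym f x : smooth f -> x != 0 ->
  (hat_hessian f x)^T = hat_hessian f x.
Proof.
move=> fs x0; pose D i : 'rV[R]_n :=
  \row_k 'D_(delta_mx 0 k) ('D_(delta_mx 0 i) (f \o normalize)) x.
have D1 : \forall y \near x, forall i, derivable (f \o normalize) y (delta_mx 0 i).
  by apply: filterS (near_neq0 x0) => y y0 k; exact: (Ck_derivable (fs 1%N) y0).
have D2 i : hasgrad ('D_(delta_mx 0 i) (f \o normalize)) x (D i).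
  exact: (Ck_hasgrad open_neq0 (Ck_derive i (fs 2%N)) x0).
have DE i k : D i 0 k = hat_hessian f x k i by rewrite [LHS]mxE [RHS]mxE.
apply/matrixP => i j; rewrite [LHS]mxE -!DE.
exact: (hessian_sym D1 D2 i j).
Qed.

(** As a function of the ambient variable, [sgrad f] is homogeneous of degree -1;
the rank one term comes from the factor [enorm] that makes it 0-homogeneous. *)
Lemma hasjac_sgrad f x : smooth f -> sphere x ->
  hasjac (sgrad f \o normalize) x (x^T *m sgrad f x + hat_hessian f x).
Proof.
move=> fs Sx; have x0 := sphere_neq0 Sx.
have := hasjacM (hasgrad_enorm x0) (hasjac_sgrad_ambient fs x0).
rewrite (enorm_sphere Sx) scale1r (normalize_sphere Sx); apply: hasjac_near.
by apply: filterS (near_neq0 x0) => y y0 /=; rewrite sgrad_normalize.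
Qed.

Lemma shessE f x : smooth f -> sphere x ->
  shess f x = tproj x *m hat_hessian f x *m tproj x.
Proof.
move=> fs Sx; rewrite /shess (hasjac_jacobian (hasjac_sgrad fs Sx)) mulmxDr.
by rewrite mulmxA tproj_mulT0// mul0mx add0r.
Qed.

Lemma D2_sym f x : smooth f -> sphere x -> (D2 f x)^T = D2 f x.
Proof.
move=> fs Sx; rewrite /D2 linearD linearZ /= shessE// !trmx_mul !tproj_tr.
by rewrite hat_hessian_sym ?sphere_neq0// mulmxA.
Qed.

Lemma D2_tproj f x : sphere x -> D2 f x *m tproj x = D2 f x.
Proof.
by move=> Sx; rewrite /D2 /shess mulmxDl -scalemxAl -!mulmxA !tproj_idem.
Qed.

Lemma tproj_D2 f x : sphere x -> tproj x *m D2 f x = D2 f x.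
Proof.
by move=> Sx; rewrite /D2 /shess mulmxDr -scalemxAr !mulmxA !tproj_idem.
Qed.

(** The gradient of the 1-homogeneous extension of [f]: for a support function,
the boundary point of the body with outer normal [x]. *)
Definition grad1 f x : 'rV[R]_n := f x *: x + sgrad f x.

(** Differentiating [dot x (sgrad f x) = 0] gives the normal component of the
derivative of [sgrad f]; the derivative of [f x *: x] cancels it. So [D2 f] is the
full Jacobian matrix, and not only its tangential part. *)
Lemma hasjac_grad1 f x : smooth f -> sphere x ->
  hasjac (grad1 f \o normalize) x (D2 f x).
Proof.
move=> fs Sx; have x0 := sphere_neq0 Sx.
have Jn := hasjac_normalize_sphere Sx.
have Js := hasjac_sgrad fs Sx.
set J := _ + _ in Js.
have xJ : x *m J = 0 by exact: hasjac_hat_radial Js.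
have JE : J = J *m tproj x - (sgrad f x)^T *m x.
  have := hasgrad_dot Js Jn.
  rewrite /= normalize_sphere// tproj_tr sgrad_tproj// => h0.
  have : hasgrad (fun y => dot (sgrad f (normalize y)) (normalize y)) x 0.
    apply: hasgrad_near (hasgrad_cst 0 x).
    apply: filterS (near_neq0 x0) => y y0.
    by rewrite dotC sgrad_radial// sphere_neq0//; exact: sphere_normalize.
  move=> /(hasgrad_uniq h0)/(congr1 trmx).
  rewrite linearD /= trmx_mul trmxK trmx0 => /eqP; rewrite addrC addr_eq0 => /eqP h1.
  by rewrite /tproj mulmxBr mulmx1 mulmxA h1 mulNmx opprK addrK.
have := hasjacD (hasjacM (smooth_hasgrad fs x0) Jn) Js.
rewrite /= normalize_sphere// => h; congr hasjac: h.
rewrite {1}JE [X in X + _]addrC -addrA [X in _ + X]addrCA subrr addr0.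
rewrite /D2 /shess (hasjac_jacobian Js); congr (_ + _).
have -> // : tproj x *m J = J by rewrite /tproj mulmxBl mul1mx -mulmxA xJ mulmx0 subr0.
Qed.

End SmoothFunctions.

Section SphereTopology.
Context {R : realType} {n : nat}.
Implicit Types (x y v d z : 'rV[R]_n).

Lemma compact_sphere : compact (sphere : set 'rV[R]_n).
Proof.
apply: bounded_closed_compact.
  exists 1; split=> // M M1 x Sx; apply/rV_normP => [|i].
    by rewrite (le_trans ler01)// ltW.
  rewrite (le_trans _ (ltW M1))// -(@ler_pXn2r _ 2)// ?nnegrE//.
  rewrite expr1n -Sx -normrX ger0_norm ?sqr_ge0// /dot (bigD1 i)//= -expr2 lerDl.
  by apply: sumr_ge0 => j _; rewrite -expr2 sqr_ge0.
rewrite (_ : sphere = (fun x => dot x x : R) @^-1` [set 1]); last by [].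
apply: closed_comp; last exact/accessible_closed_set1/hausdorff_accessible/norm_hausdorff.
by move=> x _; exact: (hasgrad_continuous (hasgrad_dot (hasjac_id x) (hasjac_id x))).
Qed.

Lemma continuous_sphere (X : topologicalType) (f : 'rV[R]_n -> X) :
  (forall x, sphere x -> {for x, continuous (f \o normalize)}) ->
  {within sphere, continuous f}.
Proof.
move=> fc; apply: (@subspace_eq_continuous _ _ _ (f \o normalize)).
  by move=> x; rewrite inE => Sx; rewrite /= normalize_sphere.
apply/continuous_in_subspaceT => x; rewrite inE; exact: fc.
Qed.

Lemma hasgrad_max (f : 'rV[R]_n -> R) x d :
  hasgrad f x d -> (\forall y \near x, f y <= f x) -> d = 0.
Proof.
move=> /hasgradP fd fx; apply/eqP; rewrite -dot_eq0 eq_le dot_ge0 andbT.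
apply/ler_addgt0Pr => e e0; rewrite add0r.
have n0 : 0 < 1 + `|d| by rewrite ltr_pwDl.
have /fd fe : 0 < e / (1 + `|d|) by rewrite divr_gt0.
have /nbhs_ballP[r1 /= r10 h1] := fe.
have /nbhs_ballP[r2 /= r20 h2] := fx.
pose s := Num.min (r1 / 2) (r2 / 2) / (1 + `|d|).
have s0 : 0 < s by rewrite divr_gt0// lt_min !divr_gt0.
have sd : `|s *: d| <= Num.min (r1 / 2) (r2 / 2).
  by rewrite normrZ gtr0_norm// /s mulrAC ler_pdivrMr// ler_wpM2l ?lerDr// le_min !divr_ge0// ltW.
have sd1 : `|s *: d| < r1.
  by move: sd; rewrite le_min => /andP[+ _]; move/le_lt_trans; apply;
    rewrite ltr_pdivrMr// ltr_pMr// ltr1n.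
have sd2 : `|s *: d| < r2.
  by move: sd; rewrite le_min => /andP[_]; move/le_lt_trans; apply;
    rewrite ltr_pdivrMr// ltr_pMr// ltr1n.
have : `|f (s *: d + x) - f x - dot (s *: d) d| <= e / (1 + `|d|) * `|s *: d|.
  by apply: h1; rewrite -ball_normE /= sub0r normrN.
have : f (s *: d + x) <= f x.
  by apply: h2; rewrite -ball_normE /= opprD addrCA subrr addr0 normrN.
rewrite dotZl normrZ gtr0_norm// => g1.
rewrite ler_distlC => /andP[_ g2].
have {g1 g2} : s * dot d d <= e / (1 + `|d|) * (s * `|d|) by lra.
rewrite [_ * (s * _)]mulrCA ler_pM2l// => /le_trans; apply.
by rewrite mulrAC ler_pdivrMr// ler_wpM2l ?(ltW e0)// lerDr.
Qed.

End SphereTopology.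

(** * The transport map is a diffeomorphism of the sphere *)

Section TransportMap.
Context {R : realType} {n : nat}.
Implicit Types (x y v d z : 'rV[R]_n) (f g u : 'rV[R]_n -> R).
Variable h : 'rV[R]_n -> R.
Hypothesis h_smooth : smooth h.
Hypothesis h_gt0 : forall x, sphere x -> 0 < h x.
Hypothesis h_pos : D2_pos h.

Lemma dot_grad1 x : sphere x -> dot x (grad1 h x) = h x.
Proof.
by move=> Sx; rewrite dotDr dotZr Sx mulr1 sgrad_radial ?addr0// sphere_neq0.
Qed.

Lemma grad1_neq0 x : sphere x -> grad1 h x != 0.
Proof.
move=> Sx; apply/eqP => N0; have := h_gt0 Sx.
by rewrite -dot_grad1// N0 dot0r ltxx.
Qed.

Lemma ray_normE x : sphere x -> ray_norm h x = enorm (grad1 h x).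
Proof.
move=> Sx; have x0 := sphere_neq0 Sx; rewrite /ray_norm /enorm; congr Num.sqrt.
rewrite /grad1 dotDl !dotDr !dotZl !dotZr Sx.
by rewrite (dotC (sgrad h x) x) sgrad_radial//; ring.
Qed.

Lemma TmapE x : sphere x -> Tmap h x = normalize (grad1 h x).
Proof. by move=> Sx; rewrite /Tmap ray_normE. Qed.

Lemma sphere_Tmap x : sphere x -> sphere (Tmap h x).
Proof.
by move=> Sx; rewrite TmapE//; apply: sphere_normalize; exact: grad1_neq0.
Qed.

Lemma D2_pos_tangent x v : sphere x -> dot x v = 0 -> 0 <= dot (v *m D2 h x) v.
Proof.
move=> Sx xv; have [->|v0] := eqVneq v 0; first by rewrite dot0r.
by rewrite ltW// h_pos.
Qed.

Lemma D2_spec x : sphere x ->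
  [/\ D2 h x *m tinv x (D2 h x) = tproj x, tinv x (D2 h x) *m D2 h x = tproj x,
      tproj x *m tinv x (D2 h x) = tinv x (D2 h x) &
      tinv x (D2 h x) *m tproj x = tinv x (D2 h x)].
Proof.
move=> Sx; apply: tinv_spec => //; [exact: tproj_D2|exact: D2_tproj|].
move=> v xv vD; apply/eqP; apply: contraT => v0.
by have := h_pos Sx xv v0; rewrite vD dot0l ltxx.
Qed.

Lemma tinv_sym x : sphere x -> (tinv x (D2 h x))^T = tinv x (D2 h x).
Proof.
move=> Sx; have [s1 s2 s3 s4] := D2_spec Sx; set t := tinv _ _ in s1 s2 s3 s4 *.
have e1 : t^T *m D2 h x = tproj x.
  by rewrite -{1}(D2_sym h_smooth Sx) -trmx_mul s1 tproj_tr.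
have e2 : t^T *m tproj x = t^T by rewrite -{1}(tproj_tr x) -trmx_mul s3.
by rewrite -e2 -s1 mulmxA e1 s3.
Qed.

Lemma tinv_ge0 x v : sphere x -> 0 <= dot v (v *m tinv x (D2 h x)).
Proof.
move=> Sx; have [s1 s2 s3 s4] := D2_spec Sx; set t := tinv _ _ in s1 s2 s3 s4 *.
have xw : dot x (v *m t) = 0 by rewrite -s4 mulmxA dot_mul_tproj.
have := D2_pos_tangent Sx xw; rewrite -mulmxA s2.
by rewrite dot_mulmx tproj_tr -mulmxA s4.
Qed.

(** The 1-homogeneous extension of [h], with gradient [grad1 h \o normalize]. *)
Let H z : R := enorm z * (h \o normalize) z.

Let H_hasgrad z : z != 0 -> hasgrad H z (grad1 h (normalize z)).
Proof.
move=> z0; have := hasgradM (hasgrad_enorm z0) (smooth_hasgrad h_smooth z0).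
by rewrite addrC -(sgrad_normalize h_smooth).
Qed.

Let N_hasjac z : z != 0 ->
  hasjac (grad1 h \o normalize) z ((enorm z)^-1 *: D2 h (normalize z)).
Proof.
move=> z0 i.
have := @hasgrad_hat_scale _ _ (fun y => grad1 h y 0 i) (normalize z) _ (enorm z) _
   (hasjac_grad1 h_smooth (sphere_normalize z0) i).
rewrite enorm_normalize enorm_gt0 => /(_ z0).
by congr hasgrad; apply/rowP => k; rewrite !mxE.
Qed.

Let segment_neq0 x y (t : R) : sphere x -> sphere y -> y != - x -> 0 <= t <= 1 ->
  t *: (y - x) + x != 0.
Proof.
move=> Sx Sy yx /andP[t0 t1]; apply/eqP => e.
have e1 : t *: y = (1 - t) *: (- x).
  apply/eqP; rewrite -subr_eq0 -[X in _ == X]e scalerBr scalerBl scale1r.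
  by rewrite !scalerN !opprK opprD opprK addrA addrAC.
have := congr1 enorm e1; rewrite !enormZ ?subr_ge0// (enorm_sphere Sy).
have -> : enorm (- x) = 1.
  by rewrite enorm_sphere// /sphere /= dotNl dotNr opprK.
rewrite !mulr1 => tE; have t2 : t != 0 by apply/eqP => t0'; lra.
move: e1; rewrite -tE => /(scalerI t2) yx'.
by rewrite yx' eqxx in yx.
Qed.

(** [D2 h] only controls tangent directions: the point is that the chord [y - x] is
radial at no point of the segment. *)
Let segment_transverse x y (t : R) : sphere x -> sphere y -> y != x -> y != - x ->
  0 <= t <= 1 ->
  0 < dot ((y - x) *m D2 h (normalize (t *: (y - x) + x))) (y - x).
Proof.
move=> Sx Sy yx yNx t01; have z0 := segment_neq0 Sx Sy yNx t01.
set z := _ + x in z0 *; set v := y - x.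
have Sz := sphere_normalize z0.
have vPn : v *m tproj (normalize z) != 0.
  apply/eqP; rewrite mul_tproj => /eqP; rewrite subr_eq0 => /eqP vz.
  have [c vc] : exists c, v = c *: z.
    by exists (dot v (normalize z) * (enorm z)^-1); rewrite {1}vz scalerA.
  have xz : x = (1 - t * c) *: z.
    by rewrite scalerBl scale1r -scalerA -vc /z -/v addrAC subrr add0r.
  have yz : y = (1 + (1 - t) * c) *: z.
    by rewrite -[LHS](subrK x) -/v [X in _ + X]xz vc -scalerDl; congr (_ *: _); ring.
  have : (1 + (1 - t) * c) ^+ 2 = (1 - t * c) ^+ 2.
    have dz : dot z z != 0 by rewrite dot_eq0.
    have sq (a : R) : a ^+ 2 * dot z z = dot (a *: z) (a *: z).
      by rewrite dotZl dotZr mulrA.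
    by apply: (mulIf dz); rewrite !sq -xz -yz Sx Sy.
  move/eqP; rewrite eqf_sqr => /orP[] /eqP e.
    by rewrite yz e -xz eqxx in yx.
  by rewrite yz e scaleNr -xz eqxx in yNx.
have := h_pos Sz (dot_mul_tproj v Sz) vPn.
by rewrite -mulmxA tproj_D2// dot_mulmx D2_sym// dot_mulmx -mulmxA tproj_D2 // D2_sym.
Qed.

(** Strict convexity of the 1-homogeneous extension of [h] across rays, by two mean
value theorems on the segment from [x] to [y]. When [y = - x] the segment meets
the origin, where the extension is not differentiable, but then the two sides
have opposite signs. *)
Lemma grad1_strict_support x y : sphere x -> sphere y -> x != y ->
  dot (grad1 h x) y < h y.
Proof.
move=> Sx Sy xy; have [yNx|yNx] := eqVneq y (- x).
  rewrite {1}yNx dotNr dotC dot_grad1// (@lt_trans _ _ 0) ?h_gt0//.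
  by rewrite oppr_lt0 h_gt0.
rewrite eq_sym in xy; pose v := y - x.
pose k (t : R) := dot (grad1 h (normalize (t *: v + x))) v.
have Hd (t : R) : 0 <= t <= 1 -> is_derive t (1 : R) (fun s => H (s *: v + x)) (k t).
  move=> t01; have z0 := segment_neq0 Sx Sy yNx t01.
  have [dH dHE] := hasgrad_derive v (H_hasgrad z0).
  by rewrite /k dotC -dHE; exact: is_derive_line.
pose k' (t : R) := (enorm (t *: v + x))^-1 * dot (v *m D2 h (normalize (t *: v + x))) v.
have kd (t : R) : 0 <= t <= 1 -> is_derive t (1 : R) k (k' t).
  move=> t01; have z0 := segment_neq0 Sx Sy yNx t01.
  have J : hasgrad (fun z => dot (grad1 h (normalize z)) v) (t *: v + x)
      ((enorm (t *: v + x))^-1 *: (v *m D2 h (normalize (t *: v + x)))).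
    have := @hasgrad_dot _ _ _ (grad1 h \o normalize) (fun=> v) _ _ 0 (N_hasjac z0).
    rewrite trmx0 mulmx0 add0r linearZ /= D2_sym//; last exact: sphere_normalize.
    by rewrite -scalemxAr; apply; exact: hasjac_cst.
  have [dH dHE] := hasgrad_derive v J.
  by rewrite /k' -dotZl dotC -dHE; exact: (is_derive_line dH).
have dc (F F' : R -> R) (a b : R) : 0 <= a -> b <= 1 ->
    (forall t : R, 0 <= t <= 1 -> is_derive t (1 : R) F (F' t)) ->
    a < b -> exists2 c, a < c < b & F b - F a = F' c * (b - a).
  move=> a0 b1 FF ab.
  have ab01 (t : R) : a <= t <= b -> 0 <= t <= 1.
    by move=> /andP[h1 h2]; rewrite (le_trans a0 h1) (le_trans h2 b1).
  have [||c cab ->] := @MVT R F F' a b ab.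
  - by move=> t /subset_itv_oo_cc; rewrite in_itv => /ab01/FF.
  - apply: continuous_in_subspaceT => t; rewrite inE /= in_itv /= => /ab01/FF[dF _].
    exact/differentiable_continuous/derivable1_diffP.
  - by exists c => //; rewrite in_itv in cab.
have [c /andP[c0 c1] e1] := dc _ _ 0 1 (lexx _) (lexx _) Hd ltr01.
have [c' /andP[c'0 c'1] e2] := dc _ _ 0 c (lexx _) (ltW c1) kd c0.
have k'0 : 0 < k' c'.
  have c'01 : 0 <= c' <= 1 by rewrite (ltW c'0)/= (le_trans (ltW c'1))// ltW.
  by rewrite /k' mulr_gt0 ?invr_gt0 ?enorm_gt0 ?segment_neq0// segment_transverse.
move: e1; rewrite scale1r scale0r add0r subrK subr0 mulr1 => e1.
have : 0 < k c - k 0 by rewrite e2 subr0 mulr_gt0.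
rewrite -e1 /k scale0r add0r normalize_sphere// dotDr dotNr (dotC _ x) dot_grad1//.
by rewrite /H /= (enorm_sphere Sx) (enorm_sphere Sy) (normalize_sphere Sx) (normalize_sphere Sy) !mul1r
  opprB addrA subrK subr_gt0.
Qed.

(** If the boundary points of the body with normals [x] and [y] were on the same
ray, [grad1_strict_support] would make each of them the nearer to the origin. *)
Lemma Tmap_inj x y : sphere x -> sphere y -> Tmap h x = Tmap h y -> x = y.
Proof.
move=> Sx Sy; rewrite !TmapE// => Txy; apply/eqP; apply: contraT => xy.
have a0 : 0 < enorm (grad1 h x) by rewrite enorm_gt0 grad1_neq0.
have b0 : 0 < enorm (grad1 h y) by rewrite enorm_gt0 grad1_neq0.
set a := enorm (grad1 h x) in a0; set b := enorm (grad1 h y) in b0.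
pose t := normalize (grad1 h x).
have Nx : grad1 h x = a *: t by rewrite enorm_normalize.
have Ny : grad1 h y = b *: t by rewrite /t Txy enorm_normalize.
have hx : h x = a * dot t x by rewrite -(dot_grad1 Sx) Nx dotZr dotC.
have hy : h y = b * dot t y by rewrite -(dot_grad1 Sy) Ny dotZr dotC.
have tx : 0 < dot t x by have := h_gt0 Sx; rewrite hx (pmulr_rgt0 _ a0).
have ty : 0 < dot t y by have := h_gt0 Sy; rewrite hy (pmulr_rgt0 _ b0).
have := grad1_strict_support Sx Sy xy; rewrite Nx hy dotZl ltr_pM2r// => ab.
rewrite eq_sym in xy; have := grad1_strict_support Sy Sx xy.
by rewrite Ny hx dotZl ltr_pM2r// => /(lt_trans ab); rewrite ltxx.
Qed.

Lemma hasjac_Tmap x : sphere x -> hasjac (Tmap h \o normalize) x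
  (D2 h x *m ((ray_norm h x)^-1 *: tproj (Tmap h x))).
Proof.
move=> Sx; have := hasjac_comp (hasjac_grad1 h_smooth Sx) (@hasjac_normalize _ _ _ _).
rewrite /= normalize_sphere// => /(_ (grad1_neq0 Sx)).
rewrite -(TmapE Sx) -(ray_normE Sx); apply: hasjac_near.
apply: filterS (near_neq0 (sphere_neq0 Sx)) => y y0 /=.
by rewrite TmapE//; exact: sphere_normalize.
Qed.

Lemma continuous_Tmap : {within sphere, continuous (Tmap h)}.
Proof. by apply: continuous_sphere => x Sx; exact: hasjac_continuous (hasjac_Tmap Sx). Qed.

(** A maximum point [x] of [dot x y / h x] is a critical point, and the critical
point equation says that [grad1 h x] is a positive multiple of [y]. *)
Lemma Tmap_surj y : sphere y -> exists2 x, sphere x & Tmap h x = y.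
Proof.
move=> Sy.
pose q x : R := dot x y * (h x)^-1.
have qd x : sphere x -> hasgrad (q \o normalize) x
    (dot x y *: (- (h x) ^- 2 *: sgrad h x) + (h x)^-1 *: (y *m tproj x)).
  move=> Sx; have x0 := sphere_neq0 Sx.
  have hx0 : (h \o normalize) x != 0 by rewrite /= normalize_sphere// gt_eqF// h_gt0.
  have hV := hasgradV (smooth_hasgrad h_smooth x0) hx0.
  have := hasgradM (hasgrad_dot (hasjac_normalize_sphere Sx) (hasjac_cst y x)) hV.
  by rewrite /= normalize_sphere// trmx0 mulmx0 add0r tproj_tr.
have qc : {within sphere, continuous q}.
  by apply: continuous_sphere => x Sx; exact: hasgrad_continuous (qd x Sx).
have [|x /[!inE] Sx xmax] := compact_EVT_max _ compact_sphere qc; first by exists y.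
have qx0 : 0 < q x.
  apply: (@lt_le_trans _ _ (q y)); last by apply: xmax; rewrite inE.
  by rewrite /q Sy mul1r invr_gt0 h_gt0.
have hx0 := h_gt0 Sx.
have xy0 : 0 < dot x y by move: qx0; rewrite /q pmulr_lgt0 ?invr_gt0.
exists x => //.
have : dot x y *: (- (h x) ^- 2 *: sgrad h x) + (h x)^-1 *: (y *m tproj x) = 0.
  apply: (hasgrad_max (qd x Sx)).
  apply: filterS (near_neq0 (sphere_neq0 Sx)) => z z0 /=.
  rewrite (normalize_sphere Sx); apply: xmax; rewrite inE; exact: sphere_normalize.
move/(congr1 (fun v => (h x / dot x y * h x) *: v)); rewrite scaler0 scalerDr !scalerA.
rewrite (_ : _ * _ * _ = - 1); last by field; rewrite !gt_eqF.
rewrite scaleN1r addrC => /eqP; rewrite subr_eq0 => /eqP sE.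
rewrite TmapE// /grad1 -sE mul_tproj scalerBr scalerA (dotC y x).
rewrite [X in _ - X *: x](_ : _ = h x); last by field; rewrite !gt_eqF.
rewrite addrC subrK normalizeZ ?normalize_sphere//.
by rewrite mulr_gt0 ?invr_gt0// mulr_gt0// divr_gt0.
Qed.

Definition Tinv y : 'rV[R]_n := xget 0 [set x | sphere x /\ Tmap h x = y].

Lemma Tinv_spec y : sphere y -> sphere (Tinv y) /\ Tmap h (Tinv y) = y.
Proof.
move=> Sy; have [x Sx Tx] := Tmap_surj Sy.
exact: (@xgetPex _ 0 [set x | sphere x /\ Tmap h x = y] (ex_intro _ x (conj Sx Tx))).
Qed.

Lemma sphere_Tinv y : sphere y -> sphere (Tinv y).
Proof. by move=> /Tinv_spec[]. Qed.

Lemma TinvK y : sphere y -> Tmap h (Tinv y) = y.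
Proof. by move=> /Tinv_spec[]. Qed.

Lemma TmapK x : sphere x -> Tinv (Tmap h x) = x.
Proof.
move=> Sx; have [S1 T1] := Tinv_spec (sphere_Tmap Sx).
exact: Tmap_inj.
Qed.

(** A continuous bijection between compact spaces maps closed sets to closed sets. *)
Lemma continuous_Tinv y : y != 0 -> {for y, continuous (Tinv \o normalize)}.
Proof.
move=> y0 O; rewrite nbhsE => -[Q [oQ Qy] QO].
pose E := [set Tmap h x | x in sphere `\` Q].
have cE : closed E.
  apply: compact_closed; first exact: norm_hausdorff.
  apply: continuous_compact.
    by apply: continuous_subspaceW continuous_Tmap; exact: subDsetl.
  by rewrite setDE; apply: compact_closedI; [exact: compact_sphere|exact: open_closedC].
have Ey : (~` E) (normalize y).
  move=> [x [Sx Qx] xy]; apply: Qx; move: Qy => /=.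
  by rewrite -xy TmapK.
have nc : {for y, continuous (normalize : 'rV[R]_n -> 'rV[R]_n)}.
  exact: hasjac_continuous (hasjac_normalize y0).
have nE : nbhs (normalize y) (~` E).
  by apply: open_nbhs_nbhs; split => //; exact: closed_openC.
have n1 := nc _ nE.
apply: filterS2 (near_neq0 y0) n1 => z z0 /= nEz; apply: QO.
have Sz := sphere_normalize z0.
apply: contrapT => nQ; apply: nEz; exists (Tinv (normalize z)); last exact: TinvK.
by split => //; exact: sphere_Tinv.
Qed.

(** The Jacobian matrix at [Tmap h x] of the inverse of the 1-homogeneous extension
of [Tmap h]. *)
Definition dTinv x : 'M[R]_n :=
  (Tmap h x)^T *m x
  + ray_norm h x *: ((1%:M - (h x)^-1 *: (x^T *m grad1 h x)) *m tinv x (D2 h x)).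

Lemma ray_norm_gt0 x : sphere x -> 0 < ray_norm h x.
Proof. by move=> Sx; rewrite ray_normE// enorm_gt0 grad1_neq0. Qed.

Lemma grad1_ray x : sphere x -> grad1 h x = ray_norm h x *: Tmap h x.
Proof.
move=> Sx; rewrite /Tmap scalerA mulfV ?scale1r// gt_eqF//.
exact: ray_norm_gt0.
Qed.

Lemma dot_Tmap x : sphere x -> dot x (Tmap h x) = h x / ray_norm h x.
Proof.
move=> Sx; have r0 := ray_norm_gt0 Sx; rewrite -[h x]dot_grad1// grad1_ray//.
by rewrite dotZr mulrAC mulfV ?mul1r// gt_eqF.
Qed.

Lemma Tmap_dTinv x : sphere x -> Tmap h x *m dTinv x = x.
Proof.
move=> Sx; have r0 := ray_norm_gt0 Sx; have h0 := h_gt0 Sx.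
rewrite /dTinv; move: (tinv _ _) => t; rewrite mulmxDr mulmxA mulmx_tr_dot (sphere_Tmap Sx) mul1mx.
rewrite -scalemxAr mulmxA mulmxBr mulmx1 -scalemxAr mulmxA mulmx_tr_dot.
rewrite mul_scalar_mx scalerA (dotC _ x) dot_Tmap// grad1_ray// scalerA.
rewrite (_ : _ * _ * _ = 1); last by field; rewrite !gt_eqF.
by rewrite scale1r subrr mul0mx scaler0 addr0.
Qed.

Lemma tangent_dTinv x v : sphere x -> dot x v = 0 ->
  v *m dTinv x = dot v (Tmap h x) *: x + ray_norm h x *: (v *m tinv x (D2 h x)).
Proof.
move=> Sx xv; rewrite /dTinv; move: (tinv _ _) => t; rewrite mulmxDr mulmxA mulmx_tr_dot mul_scalar_mx.
congr (_ + _); rewrite -scalemxAr; congr (_ *: _).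
rewrite mulmxA mulmxBr mulmx1 -scalemxAr mulmxA mulmx_tr_dot dotC xv.
by rewrite mul_scalar_mx scale0r scaler0 subr0.
Qed.

Lemma D2_mulT0 u x : sphere x -> D2 u x *m x^T = 0.
Proof. by move=> Sx; rewrite -D2_tproj// -mulmxA tproj_mulT0// mulmx0. Qed.

Lemma mul_D2_0 u x : sphere x -> x *m D2 u x = 0.
Proof. by move=> Sx; rewrite -tproj_D2// mulmxA mul_tproj0// mul0mx. Qed.

Lemma D2_dTinv (B : 'M[R]_n) x : sphere x -> B *m x^T = 0 ->
  B *m dTinv x = B *m (Tmap h x)^T *m x + ray_norm h x *: (B *m tinv x (D2 h x)).
Proof.
move=> Sx Bx; rewrite /dTinv; move: (tinv _ _) => t; rewrite mulmxDr mulmxA; congr (_ + _).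
rewrite -scalemxAr; congr (_ *: _).
by rewrite mulmxA mulmxBr mulmx1 -scalemxAr mulmxA Bx mul0mx scaler0 subr0.
Qed.

Lemma dTinvK x : sphere x ->
  (x^T *m Tmap h x + D2 h x *m ((ray_norm h x)^-1 *: tproj (Tmap h x))) *m dTinv x
  = 1%:M.
Proof.
move=> Sx; have r0 := ray_norm_gt0 Sx; have ST := sphere_Tmap Sx.
have [s1 _ _ _] := D2_spec Sx.
rewrite mulmxDl -mulmxA Tmap_dTinv// -scalemxAr -scalemxAl -mulmxA.
rewrite {1}/tproj mulmxBl mul1mx -[_ *m _ *m dTinv x]mulmxA Tmap_dTinv//.
rewrite mulmxBr D2_dTinv// ?D2_mulT0// mulmxA addrAC subrr add0r scalerA mulVf ?gt_eqF//.
by rewrite scale1r s1 /tproj addrC subrK.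
Qed.

(** The 0-homogeneous extension of [Tmap h] is singular in the radial direction; the
1-homogeneous extensions of [Tmap h] and [Tinv] are inverse to each other with
invertible Jacobian matrices, and [Z \o normalize] does not see the difference. *)
Lemma hasjac_comp_Tinv (Z : 'rV[R]_n -> 'rV[R]_n) x B : sphere x ->
  hasjac (Z \o normalize) x B ->
  hasjac ((Z \o Tinv) \o normalize) (Tmap h x) (dTinv x *m B).
Proof.
move=> Sx ZB; have ST := sphere_Tmap Sx.
have T0 := sphere_neq0 ST; have x0 := sphere_neq0 Sx.
pose F z := enorm z *: Tmap h (normalize z).
pose G z := enorm z *: Tinv (normalize z).
have Fx : F x = Tmap h x by rewrite /F enorm_sphere// scale1r normalize_sphere.
have JF : hasjac F x
    (x^T *m Tmap h x + D2 h x *m ((ray_norm h x)^-1 *: tproj (Tmap h x))).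
  have := hasjacM (hasgrad_enorm x0) (hasjac_Tmap Sx).
  by rewrite /= normalize_sphere// enorm_sphere// scale1r.
have GF : G (F x) = x.
  by rewrite Fx /G enorm_sphere// scale1r normalize_sphere// TmapK.
have cG : {for F x, continuous G}.
  rewrite Fx; apply: (@continuousZ _ _ _ enorm (Tinv \o normalize)).
    exact: hasgrad_continuous (hasgrad_enorm T0).
  exact: continuous_Tinv.
have FG : \forall z \near F x, F (G z) = z.
  rewrite Fx; apply: filterS (near_neq0 T0) => z z0.
  have Sz := sphere_normalize z0.
  rewrite /F /G enormZ ?enorm_ge0// normalizeZ ?enorm_gt0//.
  rewrite (normalize_sphere (sphere_Tinv Sz)) TinvK// (enorm_sphere (sphere_Tinv Sz)).
  by rewrite mulr1 enorm_normalize.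
have JG := hasjac_inverse JF (dTinvK Sx) GF cG FG.
have ZB' : hasjac (Z \o normalize) (G (F x)) B by rewrite GF.
have := hasjac_comp JG ZB'; rewrite Fx; apply: hasjac_near.
apply: filterS (near_neq0 T0) => z z0.
have Sz := sphere_normalize z0.
by rewrite /= /G normalizeZ ?enorm_gt0// (normalize_sphere (sphere_Tinv Sz)).
Qed.

End TransportMap.

(** * The pointwise trace identity *)

Section TraceIdentity.
Context {R : realType} {n : nat}.
Implicit Types (x y v d z : 'rV[R]_n) (f g u W : 'rV[R]_n -> R).
Variable h : 'rV[R]_n -> R.
Hypothesis h_smooth : smooth h.
Hypothesis h_gt0 : forall x, sphere x -> 0 < h x.
Hypothesis h_pos : D2_pos h.

Lemma mxtrace_mul_col_row v w : \tr (v^T *m w) = dot w v.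
Proof. by rewrite mxtrace_mulC mulmx_tr_dot /mxtrace big_ord1 mxE mulr1n. Qed.

(** The velocity of the map [T] when [h] moves in the direction [u], weighted by
[g]: a field of tangent vectors at [T x]. *)
Definition velocity u g x : 'rV[R]_n :=
  (g x / ray_norm h x) *: (grad1 u x *m tproj (Tmap h x)).

Lemma velocity_tangent u g x : sphere x -> dot (Tmap h x) (velocity u g x) = 0.
Proof.
by move=> Sx; rewrite dotZr dot_mul_tproj ?mulr0//; exact: (sphere_Tmap h_smooth).
Qed.

(** Multiplying by [h] the quotient [f = u / h] splits [grad1 u] into a multiple
of [grad1 h], which is normal to the sphere at [T x], and [h *: sgrad f]. *)
Lemma grad1M f x : smooth f -> sphere x ->
  grad1 (fun y => h y * f y) x = f x *: grad1 h x + h x *: sgrad f x.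
Proof.
move=> fs Sx; have x0 := sphere_neq0 Sx.
have := hasgradM (smooth_hasgrad h_smooth x0) (smooth_hasgrad fs x0).
move=> /(@sgrad_hasgrad _ _ (fun y => h y * f y)).
rewrite /= (normalize_sphere Sx) /grad1 => ->.
by rewrite scalerDr scalerA mulrC -addrA [h x *: _ + _]addrC.
Qed.

Let r x := ray_norm h x.
Let T x := Tmap h x.

(** The multiple of [grad1 h] in [grad1 (h * f)] is parallel to [T x], hence removed
by the projection. What the projection subtracts from [h *: sgrad f] is a multiple
of [T x], and it cancels the radial part of the image of [sgrad f]. *)
Lemma grad1_dTinv f x : smooth f -> sphere x ->
  (grad1 (fun y => h y * f y) x *m tproj (T x)) *m dTinv h x =
  (r x * h x) *: (sgrad f x *m tinv x (D2 h x)).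
Proof.
move=> fs Sx; have x0 := sphere_neq0 Sx.
have r0 : 0 < r x := ray_norm_gt0 h_smooth h_gt0 Sx.
have TT : dot (T x) (T x) = 1 := sphere_Tmap h_smooth h_gt0 Sx.
have TK : T x *m dTinv h x = x := Tmap_dTinv h_smooth h_gt0 Sx.
have gK := tangent_dTinv h Sx (sgrad_radial fs x0).
have NT := grad1_ray h_smooth h_gt0 Sx.
rewrite -/(r x) -/(T x) in gK NT.
move: (sgrad f x *m tinv _ _) gK => w gK.
rewrite mul_tproj grad1M// NT; move: (dTinv h x) TK gK => K TK gK.
move: (T x) TT TK gK => t TT TK gK.
rewrite mulmxBl mulmxDl -!scalemxAl TK gK dotDl !dotZl TT mulr1.
by apply/rowP => i; rewrite !mxE; ring.
Qed.

Lemma hasgrad_ray_norm x : sphere x ->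
  hasgrad (r \o normalize) x (T x *m D2 h x).
Proof.
move=> Sx; have x0 := sphere_neq0 Sx.
have N0 := grad1_neq0 h_smooth h_gt0 Sx.
have := @hasgrad_comp _ _ _ (grad1 h \o normalize) enorm x _ _ (hasjac_grad1 h_smooth Sx).
rewrite /= (normalize_sphere Sx) => /(_ _ (hasgrad_enorm N0)).
rewrite (D2_sym h_smooth Sx) /T (TmapE h_smooth Sx); apply: hasgrad_near.
apply: filterS (near_neq0 x0) => y y0 /=.
by rewrite /r (ray_normE h_smooth (sphere_normalize y0)).
Qed.

(** Product rule for the three factors of the velocity. Against [dTinv h x], the
derivative [D2 u] of [grad1 u] has the trace that appears in [Lop]; the derivative
of [Tmap h] has trace [n - 1], as the two are inverse on tangent spaces. *)
Lemma mxtrace_dTinv_velocity u g x : smooth u -> smooth g -> sphere x ->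
  exists2 B, hasjac (velocity u g \o normalize) x B &
  \tr (dTinv h x *m B) =
    dot (grad1 u x *m tproj (T x) *m dTinv h x)
        ((r x)^-1 *: sgrad g x - (g x / r x ^+ 2) *: (T x *m D2 h x))
    + g x * \tr (D2 u x *m tinv x (D2 h x))
    - (n%:R - 1) * (g x / r x) * dot (grad1 u x) (T x).
Proof.
move=> us gs Sx; have x0 := sphere_neq0 Sx.
have r0 : 0 < r x := ray_norm_gt0 h_smooth h_gt0 Sx.
have ST : sphere (T x) := sphere_Tmap h_smooth h_gt0 Sx.
have JT : hasjac (T \o normalize) x _ := hasjac_Tmap h_smooth h_gt0 Sx.
have TK : T x *m dTinv h x = x := Tmap_dTinv h_smooth h_gt0 Sx.
set A := D2 h x *m _ in JT.
have JM := hasjac_grad1 us Sx.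
have JgM := hasgrad_dot JM JT.
set gc := _ + _ in JgM.
have xgc : dot x gc = 0.
  exact: (@hasgrad_hat_radial _ _ (fun y => dot (grad1 u y) (T y))) JgM.
have rN0 : (r \o normalize) x != 0 by rewrite /= (normalize_sphere Sx) gt_eqF.
have Ja := hasgradM (smooth_hasgrad gs x0) (hasgradV (hasgrad_ray_norm Sx) rN0).
have JZ := hasjacM Ja (hasjacD JM (hasjacN (hasjacM JgM JT))).
rewrite (_ : (fun y => _ *: _) = velocity u g \o normalize) in JZ; last first.
  by apply/funext => y; rewrite /= /velocity mul_tproj.
eexists; first exact: JZ.
rewrite /= (normalize_sphere Sx) -mul_tproj.
set a := _ + (r x)^-1 *: _.
have -> : a = (r x)^-1 *: sgrad g x - (g x / r x ^+ 2) *: (T x *m D2 h x).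
  by rewrite /a addrC scalerA mulrN scaleNr.
set b := _ - _ *: (T x *m _).
have KJ := dTinvK h_smooth h_gt0 h_pos Sx; rewrite -/(T x) -/A in KJ.
have KD := D2_dTinv h Sx (D2_mulT0 u Sx); rewrite -/(T x) -/(r x) in KD.
move: (dTinv h x) TK KJ KD => K TK KJ KD.
rewrite mulmxDr mxtraceD (mxtrace_mulC K) -(mulmxA b^T) mxtrace_mul_col_row.
rewrite -[RHS]addrA; congr (_ + _).
have lin (X Y Z : 'M[R]_n) (c : R) : \tr (K *m (X - (Y + c *: Z))) =
    \tr (K *m X) - (\tr (K *m Y) + c * \tr (K *m Z)).
  by rewrite mulmxBr mulmxDr linearB /= mxtraceD -scalemxAr mxtraceZ.
rewrite -scalemxAr mxtraceZ lin.
have -> : \tr (K *m (gc^T *m T x)) = 0.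
  by rewrite mxtrace_mulC -mulmxA TK mxtrace_mul_col_row.
rewrite add0r.
have -> : \tr (K *m A) = n%:R - 1.
  have := congr1 mxtrace KJ.
  rewrite mxtrace1 mulmxDl mxtraceD -mulmxA TK mxtrace_mul_col_row Sx.
  by rewrite (mxtrace_mulC A) => <-; rewrite addrAC subrr add0r.
have -> : \tr (K *m D2 u x) = r x * \tr (D2 u x *m tinv x (D2 h x)).
  rewrite mxtrace_mulC KD mxtraceD mxtraceZ.
  rewrite mxtrace_mulC mulmxA (mul_D2_0 u Sx) mul0mx.
  by rewrite mxtrace0 add0r.
by field; rewrite gt_eqF.
Qed.

(** The pointwise identity behind the integration by parts: the left-hand side is
the divergence at [T x], for the measure of density [expR (- W)], of the
transported velocity field. *)
Lemma divergence_velocity f g W x : smooth f -> smooth g -> sphere x ->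
  dot (T x) (sgrad W (T x)) = 0 ->
  (exists2 B, hasjac (velocity (fun y => h y * f y) g \o normalize) x B &
  \tr (dTinv h x *m B) =
    h x * dot (sgrad g x) (sgrad f x *m tinv x (D2 h x)) + g x * Lop W h f x
    + dot (sgrad W (T x)) (velocity (fun y => h y * f y) g x)).
Proof.
move=> fs gs Sx TW; have us : smooth (fun y => h y * f y) by exact: smoothM.
have x0 := sphere_neq0 Sx.
have r0 : 0 < r x := ray_norm_gt0 h_smooth h_gt0 Sx.
have TT : dot (T x) (T x) = 1 := sphere_Tmap h_smooth h_gt0 Sx.
have [B JB tB] := mxtrace_dTinv_velocity us gs Sx.
exists B => //; rewrite {B JB}tB grad1_dTinv//.
have [s1 s2 s3 s4] := D2_spec h_pos Sx.
have fT : dot (sgrad f x *m tinv x (D2 h x)) (T x *m D2 h x) = dot (sgrad f x) (T x).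
  rewrite -{2}(D2_sym h_smooth Sx) -dot_mulmx -mulmxA s2.
  by rewrite sgrad_tproj.
have cE : dot (grad1 (fun y => h y * f y) x) (T x) =
    f x * r x + h x * dot (sgrad f x) (T x).
  rewrite grad1M// (grad1_ray h_smooth h_gt0 Sx) -/(r x) -/(T x).
  by move: (T x) TT => t TT; rewrite dotDl !dotZl TT mulr1.
have LE : Lop W h f x = \tr (D2 (fun y => h y * f y) x *m tinv x (D2 h x))
  - dot (sgrad W (T x) + n%:R *: T x) ((r x)^-1 *: grad1 (fun y => h y * f y) x) + f x.
  by [].
rewrite {}LE /velocity -/(T x) -/(r x).
move: (sgrad f x *m _) fT => w; move: (T x) TT TW cE => t TT TW cE fT.
rewrite dotZl dotDr dotNr !dotZr fT dotDl dotZl mul_tproj dotDr dotNr dotZr.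
rewrite (dotC (sgrad W t) t) TW (dotC t (grad1 _ _)) cE (dotC (sgrad g x)).
move: (\tr _) (dot w _) (dot (sgrad f x) t) (dot (sgrad W t) _) => a b c d.
by field; rewrite gt_eqF.
Qed.

End TraceIdentity.

(** * Smooth fields of vectors and matrices *)

Section SmoothClosure.
Context {R : realType} {n : nat}.
Implicit Types (x y v d z : 'rV[R]_n) (f g h u : 'rV[R]_n -> R).

Lemma smoothN f : smooth f -> smooth (fun x => - f x).
Proof.
move=> fs; under eq_fun do rewrite -mulN1r.
by apply: smoothM => //; exact: smooth_cst.
Qed.

Lemma smooth_sum (I : Type) (r : seq I) (F : I -> 'rV[R]_n -> R) :
  (forall i, smooth (F i)) -> smooth (fun x => \sum_(i <- r) F i x).
Proof.
move=> Fs; elim: r => [|i r IH].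
  by under eq_fun do rewrite big_nil; exact: smooth_cst.
by under eq_fun do rewrite big_cons; exact: smoothD.
Qed.

Lemma smooth_prod (I : Type) (r : seq I) (F : I -> 'rV[R]_n -> R) :
  (forall i, smooth (F i)) -> smooth (fun x => \prod_(i <- r) F i x).
Proof.
move=> Fs; elim: r => [|i r IH].
  by under eq_fun do rewrite big_nil; exact: smooth_cst.
by under eq_fun do rewrite big_cons; exact: smoothM.
Qed.

Lemma Ck_coord k i : Ck k [set x | x != 0] (fun x : 'rV[R]_n => x 0 i).
Proof.
case: k => [|k].
  by split=> // x _; exact: hasgrad_continuous (hasgrad_coord i x).
apply: (CkS_hasgrad open_neq0 (G := fun j _ => (j == i)%:R)).
  move=> x _; have := hasgrad_coord i x; congr hasgrad.
  by apply/rowP => j; rewrite !mxE eqxx.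
by move=> j; exact: (Ck_cst open_neq0).
Qed.

Lemma Ck_enorm k : Ck k [set x | x != 0] (enorm : 'rV[R]_n -> R).
Proof.
elim: k => [|k IH].
  by split=> // x x0; exact: hasgrad_continuous (hasgrad_enorm x0).
apply: (CkS_hasgrad open_neq0 (G := fun i x => (enorm x)^-1 * x 0 i)).
  move=> x x0; have := hasgrad_enorm x0; congr hasgrad.
  by apply/rowP => j; rewrite !mxE.
move=> i; apply: (Ck_M open_neq0); last exact: Ck_coord.
by apply: (Ck_V open_neq0) => // x; rewrite /= -enorm_eq0.
Qed.

Lemma smooth_coord i : smooth (fun x : 'rV[R]_n => x 0 i).
Proof.
move=> k; apply: (eq_Ck open_neq0 (f := fun x => (enorm x)^-1 * x 0 i)).
  by move=> x _; rewrite /= mxE.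
apply: (Ck_M open_neq0); last exact: Ck_coord.
apply: (Ck_V open_neq0); last exact: Ck_enorm.
by move=> x; rewrite /= -enorm_eq0.
Qed.

Lemma smooth_sgrad f i : smooth f -> smooth (fun x => sgrad f x 0 i).
Proof.
move=> fs k.
apply: (eq_Ck open_neq0 (f := fun x => enorm x * 'D_(delta_mx 0 i) (f \o normalize) x)).
  by move=> x x0; rewrite /= (sgrad_normalize fs x0) !mxE.
apply: (Ck_M open_neq0); first exact: Ck_enorm.
exact: Ck_derive i (fs k.+1).
Qed.

Definition smooth_mx m p (A : 'rV[R]_n -> 'M[R]_(m, p)) : Prop :=
  forall i j, smooth (fun x => A x i j).

Lemma eq_smooth_mx m p (A B : 'rV[R]_n -> 'M[R]_(m, p)) :
  (forall x, sphere x -> A x = B x) -> smooth_mx A -> smooth_mx B.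
Proof. by move=> AB As i j; apply: eq_smooth (As i j) => x Sx; rewrite AB. Qed.

Lemma smooth_mx_cst m p (A : 'M[R]_(m, p)) : smooth_mx (fun=> A).
Proof. by move=> i j; exact: smooth_cst. Qed.

Lemma smooth_mx_id : smooth_mx (fun x : 'rV[R]_n => x).
Proof. by move=> i j; rewrite (ord1 i); exact: smooth_coord. Qed.

Lemma smooth_mx_sgrad f : smooth f -> smooth_mx (sgrad f).
Proof. by move=> fs i j; rewrite (ord1 i); exact: smooth_sgrad. Qed.

Lemma smooth_mxD m p (A B : 'rV[R]_n -> 'M[R]_(m, p)) :
  smooth_mx A -> smooth_mx B -> smooth_mx (fun x => A x + B x).
Proof.
by move=> As Bs i j; under eq_fun do rewrite mxE; exact: smoothD.
Qed.

Lemma smooth_mxN m p (A : 'rV[R]_n -> 'M[R]_(m, p)) :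
  smooth_mx A -> smooth_mx (fun x => - A x).
Proof. by move=> As i j; under eq_fun do rewrite mxE; exact: smoothN. Qed.

Lemma smooth_mxZ m p f (A : 'rV[R]_n -> 'M[R]_(m, p)) :
  smooth f -> smooth_mx A -> smooth_mx (fun x => f x *: A x).
Proof. by move=> fs As i j; under eq_fun do rewrite mxE; exact: smoothM. Qed.

Lemma smooth_mxT m p (A : 'rV[R]_n -> 'M[R]_(m, p)) :
  smooth_mx A -> smooth_mx (fun x => (A x)^T).
Proof. by move=> As i j; under eq_fun do rewrite mxE; exact: As. Qed.

Lemma smooth_mxM m p q (A : 'rV[R]_n -> 'M[R]_(m, p)) (B : 'rV[R]_n -> 'M[R]_(p, q)) :
  smooth_mx A -> smooth_mx B -> smooth_mx (fun x => A x *m B x).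
Proof.
move=> As Bs i j; under eq_fun do rewrite mxE.
by apply: smooth_sum => k; exact: smoothM.
Qed.

Lemma smooth_dot (A B : 'rV[R]_n -> 'rV[R]_n) :
  smooth_mx A -> smooth_mx B -> smooth (fun x => dot (A x) (B x)).
Proof. by move=> As Bs; apply: smooth_sum => k; exact: smoothM. Qed.

Lemma smooth_mxtrace m (A : 'rV[R]_n -> 'M[R]_m) :
  smooth_mx A -> smooth (fun x => \tr (A x)).
Proof. by move=> As; apply: smooth_sum. Qed.

Lemma smooth_det m (A : 'rV[R]_n -> 'M[R]_m) :
  smooth_mx A -> smooth (fun x => \det (A x)).
Proof.
move=> As; rewrite /determinant; apply: smooth_sum => s.
by apply: smoothM; [exact: smooth_cst|exact: smooth_prod].
Qed.

Lemma smooth_invmx m (A : 'rV[R]_n -> 'M[R]_m) :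
  (forall x, sphere x -> A x \in unitmx) -> smooth_mx A ->
  smooth_mx (fun x => invmx (A x)).
Proof.
move=> Au As; apply: (@eq_smooth_mx _ _ (fun x => (\det (A x))^-1 *: \adj (A x))).
  by move=> x Sx; rewrite /invmx Au.
apply: smooth_mxZ.
  apply: smoothV; last exact: smooth_det.
  by move=> x /Au; rewrite unitmxE unitfE.
move=> i j; under eq_fun do rewrite mxE; apply: smoothM; first exact: smooth_cst.
by apply: smooth_det => k l; under eq_fun do rewrite !mxE; exact: As.
Qed.

Lemma smooth_jacobian (F : 'rV[R]_n -> 'rV[R]_n) (J : 'rV[R]_n -> 'M[R]_n) :
  smooth_mx F -> (forall x, sphere x -> hasjac (F \o normalize) x (J x)) ->
  smooth_mx J.
Proof.
move=> Fs FJ i j; apply: eq_smooth (smooth_sgrad i (Fs 0 j)) => x Sx.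
have E := @sgrad_hasgrad _ _ (fun y => F y 0 j) _ _ (FJ x Sx j).
by rewrite E !mxE.
Qed.

Lemma smooth_mx_grad1 f : smooth f -> smooth_mx (grad1 f).
Proof.
move=> fs; apply: smooth_mxD; last exact: smooth_mx_sgrad.
exact: smooth_mxZ smooth_mx_id.
Qed.

Lemma smooth_mx_D2 f : smooth f -> smooth_mx (D2 f).
Proof.
move=> fs; apply: (smooth_jacobian (smooth_mx_grad1 fs)) => x Sx.
exact: hasjac_grad1.
Qed.

Lemma smooth_mx_tinv h : smooth h -> D2_pos h ->
  smooth_mx (fun x => tinv x (D2 h x)).
Proof.
move=> hs hp.
have Ns : smooth_mx (fun x : 'rV[R]_n => x^T *m x).
  by apply: smooth_mxM; [exact: smooth_mxT smooth_mx_id|exact: smooth_mx_id].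
apply: smooth_mxD; last exact: smooth_mxN.
apply: smooth_invmx; last by apply: smooth_mxD => //; exact: smooth_mx_D2.
move=> x Sx; have [s1 s2 s3 s4] := D2_spec hp Sx.
have xD := mul_D2_0 h Sx; have Dx := D2_mulT0 h Sx.
have xt : x *m tinv x (D2 h x) = 0 by rewrite -s3 mulmxA mul_tproj0// mul0mx.
have E : (D2 h x + x^T *m x) *m (tinv x (D2 h x) + x^T *m x) = 1%:M.
  move: (tinv _ _) s1 s2 s3 s4 xt => t s1 s2 s3 s4 xt.
  rewrite mulmxDl !mulmxDr s1 [D2 h x *m _]mulmxA Dx mul0mx addr0.
  rewrite -[x^T *m x *m t]mulmxA xt mulmx0 add0r.
  by rewrite -mulmxA [x *m _]mulmxA mulmx_tr_dot Sx mul1mx /tproj subrK.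
by have [] := mulmx1_unit E.
Qed.

Lemma smooth_continuous f : smooth f -> {within sphere, continuous f}.
Proof.
move=> fs; apply: continuous_sphere => x Sx.
exact: hasgrad_continuous (smooth_hasgrad fs (sphere_neq0 Sx)).
Qed.

Lemma within_continuousD (A : set 'rV[R]_n) f g :
  {within A, continuous f} -> {within A, continuous g} ->
  {within A, continuous (fun x => f x + g x)}.
Proof. by move=> fc gc x; apply: continuousD; [exact: fc|exact: gc]. Qed.

Lemma within_continuousB (A : set 'rV[R]_n) f g :
  {within A, continuous f} -> {within A, continuous g} ->
  {within A, continuous (fun x => f x - g x)}.
Proof. by move=> fc gc x; apply: continuousB; [exact: fc|exact: gc]. Qed.

Lemma within_continuousM (A : set 'rV[R]_n) f g :
  {within A, continuous f} -> {within A, continuous g} ->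
  {within A, continuous (fun x => f x * g x)}.
Proof. by move=> fc gc x; apply: continuousM; [exact: fc|exact: gc]. Qed.

Lemma within_continuous_sum (A : set 'rV[R]_n) (I : Type) (r : seq I)
    (F : I -> 'rV[R]_n -> R) :
  (forall i, {within A, continuous (F i)}) ->
  {within A, continuous (fun x => \sum_(i <- r) F i x)}.
Proof.
move=> Fc; elim: r => [|i r IH].
  under eq_fun do rewrite big_nil.
  by apply: continuous_subspaceT => x; exact: cst_continuous.
under eq_fun do rewrite big_cons.
exact: within_continuousD.
Qed.

Lemma within_continuous_selfcomp (A : set 'rV[R]_n) (phi : 'rV[R]_n -> 'rV[R]_n) f :
  {within A, continuous phi} -> (forall x, A x -> A (phi x)) ->
  {within A, continuous f} -> {within A, continuous (f \o phi)}.
Proof.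
move=> /subspace_continuousP pc pA /subspace_continuousP fc.
apply/subspace_continuousP => x Ax B nB.
have := pc x Ax _ (fc (phi x) (pA x Ax) B nB).
rewrite /= /nbhs /= /within /=; apply: filterS => y h Ay.
by apply: h => //; exact: pA.
Qed.

End SmoothClosure.

(** * Measures on the sphere *)

Section MeasureSphere.
Context {R : realType} {n : nat}.
Implicit Types (sigma mu nu : probability (borel_rV R n) R).
Implicit Types (f g V W : 'rV[R]_n -> R) (phi : 'rV[R]_n -> 'rV[R]_n).

Notation S := (sphere : set (borel_rV R n)).

Lemma open_borel (U : set 'rV[R]_n) : open U -> measurable (U : set (borel_rV R n)).
Proof. by move=> oU; exact: sub_sigma_algebra. Qed.

Lemma measurable_sphere : measurable S.
Proof.
rewrite -[S]setCK; apply: measurableC; apply: open_borel.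
apply: closed_openC; apply: compact_closed; first exact: norm_hausdorff.
exact: compact_sphere.
Qed.

Lemma measurable_within_open (f : 'rV[R]_n -> R) (O : set R) :
  {within sphere, continuous f} -> open O -> measurable (S `&` f @^-1` O).
Proof.
move=> /continuousP fc oO; have := fc O oO.
move=> /open_subspaceP[V oV VE]; rewrite setIC -VE.
by apply: measurableI; [exact: open_borel|exact: measurable_sphere].
Qed.

Lemma measurable_fun_sphere f : {within sphere, continuous f} ->
  measurable_fun S (f : borel_rV R n -> R).
Proof.
move=> fc; apply: (measurability _ (RGenOpens.measurableE R)).
move=> _ [_ [a [b ->] <-]].
by apply: measurable_within_open => //; exact: interval_open.
Qed.

Lemma measurable_map_sphere phi : {within sphere, continuous phi} ->
  measurable_fun S (phi : borel_rV R n -> borel_rV R n).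
Proof.
move=> /continuousP pc; apply: (@measurability _ _ (borel_rV R n) (borel_rV R n) S phi (@open 'rV[R]_n) erefl).
move=> _ [B oB <-]; have /open_subspaceP[V oV VE] := pc B oB.
by rewrite setIC -VE; apply: measurableI; [exact: open_borel|exact: measurable_sphere].
Qed.

Lemma sphere_bounded f : {within sphere, continuous f} ->
  exists2 C, 0 < C & forall x, sphere x -> `|f x| <= C.
Proof.
move=> fc; have /ex_strict_bound_gt0[C C0 fC] : bounded_set [set f x | x in sphere].
  by apply: compact_bounded; apply: continuous_compact => //; exact: compact_sphere.
by exists C => // x Sx; apply/ltW/fC; exists x.
Qed.

Lemma sphere_integrable mu f : {within sphere, continuous f} ->
  mu.-integrable S (EFin \o f).
Proof.
move=> fc; apply: measurable_bounded_integrable.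
- exact: measurable_sphere.
- by rewrite (le_lt_trans (probability_le1 _ _)) ?ltry//; exact: measurable_sphere.
- exact: measurable_fun_sphere.
- have [C C0 fC] := sphere_bounded fc.
  exists C; split; first exact: num_real.
  by move=> M CM x Sx /=; rewrite (le_trans (fC x Sx))// ltW.
Qed.

Lemma probability_sphereC mu : mu S = 1%E -> mu (~` S) = 0%E.
Proof.
by move=> muS; rewrite probability_setC ?muS ?subee//; exact: measurable_sphere.
Qed.

Lemma probability_sphereI mu (A : set (borel_rV R n)) : mu S = 1%E ->
  measurable A -> mu (S `&` A) = mu A.
Proof.
move=> muS mA; have mS := measurable_sphere.
have AE : A = (S `&` A) `|` (A `&` ~` S).
  by rewrite setIC -setIUr setUCr setIT.
rewrite [in RHS]AE measureU//; last 3 first.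
- exact: measurableI.
- by apply: measurableI => //; exact: measurableC.
- by rewrite [A `&` _]setIC setIACA setICr set0I.
rewrite [X in (_ + X)%E](_ : _ = 0%E) ?adde0//.
apply/eqP; rewrite -measure_le0 -(probability_sphereC muS).
apply: le_measure; last exact: subIsetr.
  by rewrite inE; apply: measurableI => //; exact: measurableC.
by rewrite inE; exact: measurableC.
Qed.

Lemma transports_sphere mu nu phi : transports mu nu phi -> mu S = 1%E ->
  nu S = 1%E.
Proof.
move=> [_ pS pE] muS; rewrite -pE; last exact: measurable_sphere.
rewrite (_ : _ `&` _ = S)//; apply/seteqP; split => [x []//|x Sx].
by split => //; exact: pS.
Qed.

(** The map and the function are only controlled on the sphere: both are extended by
0 before the change of variables for image measures. *)
Lemma Rintegral_transports mu nu phi f : transports mu nu phi -> mu S = 1%E ->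
  {within sphere, continuous f} ->
  \int[mu]_(x in sphere) f (phi x) = \int[nu]_(x in sphere) f x.
Proof.
move=> tr muS fc; have [mp pS pE] := tr; have mS := measurable_sphere.
have nuS := transports_sphere tr muS.
pose phi' : borel_rV R n -> borel_rV R n := (phi : borel_rV R n -> borel_rV R n) \_ S.
have mp' : measurable_fun setT phi'.
  by apply: (measurable_restrictT _ mS).1.
have pp' x : sphere x -> phi' x = phi x.
  by move=> Sx; rewrite /phi' patchE ifT// inE.
pose F : borel_rV R n -> R := (f : borel_rV R n -> R) \_ S.
have mF : measurable_fun setT F.
  exact: (measurable_restrictT _ mS).1 (measurable_fun_sphere fc).
have FS x : sphere x -> F x = f x by move=> Sx; rewrite /F patchE ifT// inE.
have [C C0 fC] := sphere_bounded fc.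
have FC x : `|F x| <= C.
  by rewrite /F patchE; case: ifP => [|_]; rewrite ?inE ?normr0 ?(ltW C0)//; exact: fC.
have pushE A : measurable A -> A `<=` setT -> nu A = pushforward mu phi' A.
  move=> mA _; rewrite -pE// /pushforward -[RHS](probability_sphereI muS); last first.
    by rewrite -[X in measurable X]setTI; exact: mp'.
  congr (mu _); apply/seteqP; split => x [Sx /= h]; split => //=; first by rewrite pp'.
  by rewrite -pp'.
have intF : mu.-integrable setT ((EFin \o F) \o phi').
  apply: (@measurable_bounded_integrable _ _ _ _ (F \o phi')) => //.
  - by rewrite (le_lt_trans (probability_le1 _ _)) ?ltry.
  - exact: measurableT_comp.
  - exists C; split; first exact: num_real.
    by move=> M CM x _ /=; rewrite (le_trans (FC _))// ltW.
have ext (m : probability (borel_rV R n) R) (g : borel_rV R n -> R) : m S = 1%E ->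
    m.-integrable setT (EFin \o g) ->
    (\int[m]_(x in setT) (g x)%:E = \int[m]_(x in S) (g x)%:E)%E.
  move=> mS1 ig; rewrite (@negligible_integral _ _ _ m setT (~` S))//.
  - by rewrite setDE setCK setTI.
  - exact: measurableC.
  - exact: probability_sphereC.
have intFn : nu.-integrable setT (EFin \o F).
  apply: measurable_bounded_integrable => //.
  - by rewrite (le_lt_trans (probability_le1 _ _)) ?ltry.
  - exists C; split; first exact: num_real.
    by move=> M CM x _ /=; rewrite (le_trans (FC _))// ltW.
rewrite /Rintegral; congr fine.
transitivity (\int[mu]_(x in S) ((F \o phi') x)%:E)%E.
  apply: eq_integral => x; rewrite inE => Sx.
  by rewrite /= pp'// FS//; exact: pS.
transitivity (\int[nu]_(x in S) (F x)%:E)%E; last first.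
  by apply: eq_integral => x; rewrite inE => Sx; rewrite FS.
rewrite -!ext//.
rewrite (@eq_measure_integral _ _ _ setT (pushforward mu phi') nu)//.
rewrite integral_pushforward//.
exact/measurable_EFinP.
Qed.

Lemma transports_rotation sigma (Q : 'M[R]_n) : uniform_sphere sigma ->
  Q *m Q^T = 1%:M -> transports sigma sigma (fun x => x *m Q).
Proof.
move=> [sS sQ] QQ; split.
- apply: measurable_map_sphere; apply: continuous_subspaceT => x.
  apply: (@cvg_rV _ _ _ (nbhs x) (nbhs_filter x)) => i.
  rewrite -dot_col; under eq_fun do rewrite -dot_col; exact: dot_continuous.
- by move=> x Sx; rewrite /sphere /= dot_mulmx -mulmxA QQ mulmx1.
- move=> A mA; rewrite -(sQ Q QQ A mA) probability_sphereI//.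
  have mQ : measurable_fun setT ((fun x => x *m Q) : borel_rV R n -> borel_rV R n).
    apply: (@measurability _ _ (borel_rV R n) (borel_rV R n) setT _ (@open 'rV[R]_n) erefl).
    move=> _ [B oB <-]; rewrite setTI; apply: open_borel.
    apply: open_comp => // x _.
    apply: (@cvg_rV _ _ _ (nbhs x) (nbhs_filter x)) => i.
    rewrite -dot_col; under eq_fun do rewrite -dot_col; exact: dot_continuous.
  by rewrite -[X in measurable X]setTI; exact: mQ.
Qed.

Lemma gibbs_sphere sigma V mu : gibbs sigma V mu -> mu S = 1%E.
Proof.
move=> muV; rewrite -(probability_setT mu) !muV//; last exact: measurable_sphere.
by rewrite setIid setIT.
Qed.

(** A density is determined almost everywhere by its integrals over measurable sets,
so [expR (- V x)] is the Radon-Nikodym derivative of [mu]. *)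
Lemma Rintegral_gibbs sigma V mu f : sigma S = 1%E -> gibbs sigma V mu ->
  {within sphere, continuous (fun x => expR (- V x))} ->
  {within sphere, continuous f} ->
  \int[mu]_(x in sphere) f x = \int[sigma]_(x in sphere) (f x * expR (- V x)).
Proof.
move=> sS muV Vc fc; have mS := measurable_sphere.
have dom : mu `<< sigma.
  apply/null_content_dominatesP => A mA sA; rewrite muV//.
  apply: null_set_integral.
  - exact: measurableI.
  - apply: (measurable_funS mS); first exact: subIsetl.
    by apply/measurable_EFinP; exact: measurable_fun_sphere.
  - exact: etrans (probability_sphereI sS mA) sA.
have iV := sphere_integrable sigma Vc.
have ae : ae_eq sigma S (fun x => (expR (- V x))%:E)
    (Radon_Nikodym (charge_of_finite_measure mu) sigma).
  apply: integral_ae_eq => //.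
    by apply: measurable_funTS.
  move=> E ES mE; rewrite -Radon_Nikodym_integral//=.
  rewrite -[RHS]/(mu E) muV// (_ : sphere `&` E = E)//.
  by apply/seteqP; split => [x []//|x Ex]; split => //; exact: ES.
rewrite /Rintegral; congr fine.
rewrite -(Radon_Nikodym_change_of_variables dom mS (sphere_integrable mu fc)).
apply: ae_eq_integral => //.
- apply: emeasurable_funM; last exact: measurable_funTS.
  by apply/measurable_EFinP; exact: measurable_fun_sphere.
- apply/measurable_EFinP; apply: measurable_fun_sphere.
  exact: within_continuousM.
- by apply: filterS ae => x h Sx /=; rewrite -h// EFinM.
Qed.

End MeasureSphere.

(** * Rotations and the divergence theorem *)

Section Rotation.
Context {R : realType} {n : nat}.
Implicit Types (sigma : probability (borel_rV R n) R) (x : 'rV[R]_n).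
Implicit Types (A : 'M[R]_n) (F : 'rV[R]_n -> R).

(** Rodrigues' formula: the exponential of [t *: A] when [A] is the generator of a
rotation, that is, when [A] is skew with [A ^ 3 = - A]. *)
Definition rotation A (t : R) : 'M[R]_n :=
  1%:M + sin t *: A + (1 - cos t) *: (A *m A).

Lemma rotation_orthogonal A t : A^T = - A -> A *m A *m A = - A ->
  rotation A t *m (rotation A t)^T = 1%:M.
Proof.
move=> AT A3; pose B := A *m A.
have BB : B *m B = - B by rewrite /B mulmxA A3 mulNmx.
have BA : B *m A = - A by [].
have AB : A *m B = - A by rewrite /B mulmxA.
have BT : B^T = B by rewrite /B trmx_mul AT mulmxN mulNmx opprK.
rewrite /rotation -/B.
have := cos2Dsin2 t; set c := cos t; set s := sin t => cs.
pose e := 1 - c; have s2 : s * s = 2 * e - e * e.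
  by rewrite -expr2 -[s ^+ 2](addKr (c ^+ 2)) cs /e; ring.
rewrite -/e; clearbody e => {cs c}.
pose X := 1%:M - s *: A + e *: B.
have -> : (1%:M + s *: A + e *: B)^T = X.
  by rewrite !linearD !linearZ /= trmx1 AT BT scalerN.
have AX : A *m X = A - s *: B - e *: A.
  by rewrite /X mulmxDr mulmxBr mulmx1 -!scalemxAr -/B AB scalerN.
have BX : B *m X = B + s *: A - e *: B.
  by rewrite /X mulmxDr mulmxBr mulmx1 -!scalemxAr BA BB !scalerN opprK.
rewrite !mulmxDl mul1mx -!scalemxAl AX BX /X.
move: B {BB BA AB BT X AX BX} => B.
apply/matrixP => i j; rewrite !mxE.
transitivity ((i == j)%:R + (2 * e - s * s - e * e) * B i j); first by ring.
by rewrite s2; ring.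
Qed.

Lemma is_derive_rotation A F d x t : A *m A *m A = - A ->
  hasgrad F (x *m rotation A t) d ->
  is_derive t (1 : R) (fun s => F (x *m rotation A s))
    (dot (x *m rotation A t *m A) d).
Proof.
move=> A3 /hasgrad_is_diff Fd.
have dZ (k : R -> R) (k' : R) (v : 'rV[R]_n) : is_derive t (1 : R) k k' ->
    is_diff t (fun s => k s *: v) (fun u => (u * k') *: v).
  move=> [dk kE]; have dk' : differentiable k t by exact/derivable1_diffP.
  apply: DiffDef; first exact: differentiableZl.
  by rewrite diffZl//; apply/funext => u; rewrite deriv1E// derive1E kE.
have d1 := dZ _ _ (x *m A) (is_derive_sin t).
have d2' : is_derive t (1 : R) (fun s : R => 1 - cos s) (sin t).
  by have := is_deriveB (is_derive_cst (1 : R) t 1) (is_derive_cos t); rewrite sub0r opprK.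
have d2 := dZ _ _ (x *m (A *m A)) d2'.
have dg := is_diffD (is_diffD (is_diff_cst x t) d1) d2.
set dgamma := (X in is_diff _ _ X) in dg.
have gE : (cst x + (fun s => sin s *: (x *m A)) + (fun s => (1 - cos s) *: (x *m (A *m A))))
   = (fun s => x *m rotation A s).
  by apply/funext => s; rewrite /rotation !mulmxDr mulmx1 -!scalemxAr.
rewrite gE in dg.
have := @is_diff_comp _ _ _ _ _ _ F _ t dg Fd.
rewrite -[F \o _]/(fun s => F (x *m rotation A s)) => -[dF dFE].
apply: DeriveDef; first exact: diff_derivable.
rewrite deriveE// dFE /= /dgamma; congr dot.
rewrite -[LHS]/(0 + (1 * cos t) *: (x *m A) + (1 * sin t) *: (x *m (A *m A))).
rewrite add0r !mul1r -mulmxA /rotation !mulmxDl mul1mx -!scalemxAl A3.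
rewrite !mulmxDr -!scalemxAr mulmxN.
by apply/rowP => i; rewrite !mxE; ring.
Qed.

(** By invariance, the integral of [F] is constant along the flow of rotations. Its
derivative at time 0 is taken under the integral sign by dominated convergence:
the mean value theorem bounds the difference quotients. *)
Lemma Rintegral_rotation_generator sigma A F (G : 'rV[R]_n -> 'rV[R]_n) :
  uniform_sphere sigma -> A^T = - A -> A *m A *m A = - A ->
  (forall x, sphere x -> hasgrad F x (G x)) ->
  {within sphere, continuous (fun x => dot (x *m A) (G x))} ->
  \int[sigma]_(x in sphere) (dot (x *m A) (G x)) = 0.
Proof.
move=> su AT A3 FG Dc; have mS := @measurable_sphere R n.
have [sS _] := su.
have QS x t : sphere x -> sphere (x *m rotation A t).
  by move=> Sx; rewrite /sphere /= dot_mulmx -mulmxA rotation_orthogonal// mulmx1.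
have Fc : {within sphere, continuous F}.
  apply/continuous_in_subspaceT => x; rewrite inE => Sx.
  exact: hasgrad_continuous (FG x Sx).
pose D x := dot (x *m A) (G x).
have [C C0 DC] := sphere_bounded Dc.
pose t_ k : R := harmonic k.
have t0 k : 0 < t_ k by exact: harmonic_gt0.
pose q k x := (t_ k)^-1 * (F (x *m rotation A (t_ k)) - F x).
have FQc k : {within sphere, continuous (fun x => F (x *m rotation A (t_ k)))}.
  have mQc : {within sphere, continuous (fun x : 'rV[R]_n => x *m rotation A (t_ k))}.
    apply: continuous_subspaceT => x.
    apply: (@cvg_rV _ _ _ (nbhs x) (nbhs_filter x)) => i.
    rewrite -dot_col; under eq_fun do rewrite -dot_col; exact: dot_continuous.
  exact: (within_continuous_selfcomp mQc (fun x => QS x (t_ k)) Fc).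
have FNc : {within sphere, continuous (fun x => - F x)}.
  by move=> x; apply: continuousN; exact: Fc.
have qc k : {within sphere, continuous (q k)}.
  apply: within_continuousM; last exact: within_continuousD.
  by apply: continuous_subspaceT => x; exact: cst_continuous.
have q0 k : \int[sigma]_(x in sphere) q k x = 0.
  rewrite /q RintegralZl//; last first.
    exact: (sphere_integrable sigma (within_continuousD (FQc k) FNc)).
  rewrite RintegralB//; last 2 first.
  - exact: (sphere_integrable sigma (FQc k)).
  - exact: (sphere_integrable sigma Fc).
  rewrite (@Rintegral_transports _ _ sigma sigma (fun x => x *m rotation A (t_ k)) F)//.
    by rewrite subrr mulr0.
  by apply: transports_rotation => //; exact: rotation_orthogonal.
have rot0 : rotation A 0 = 1%:M.
  by rewrite /rotation sin0 cos0 subrr !scale0r !addr0.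
have dF x t : sphere x ->
    is_derive t (1 : R) (fun s => F (x *m rotation A s)) (D (x *m rotation A t)).
  move=> Sx; apply: is_derive_rotation => //.
  exact: FG (QS x t Sx).
have qC k x : sphere x -> `|q k x| <= C.
  move=> Sx.
  have [||c _] := @MVT _ (fun s => F (x *m rotation A s))
     (fun s => D (x *m rotation A s)) _ _ (t0 k).
  - by move=> t _; exact: dF.
  - apply: continuous_subspaceT => t; apply: differentiable_continuous.
    by apply/derivable1_diffP; have [] := dF x t Sx.
  rewrite rot0 mulmx1 subr0 /q => ->.
  by rewrite mulrCA mulVf ?gt_eqF// mulr1; exact: DC (QS _ _ Sx).
have qD x : sphere x -> (fun k => q k x) @ \oo --> D x.
  move=> Sx; have [dFx dFE] := dF x 0 Sx.
  have : (fun h => h^-1 *: (((fun s => F (x *m rotation A s)) \o shift 0) (h *: (1 : R))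
      - F (x *m rotation A 0))) @ 0^' --> D x.
    by rewrite -[x in D x]mulmx1 -rot0 -dFE.
  have tc : t_ @ \oo --> (0 : R)^'.
    move=> P; rewrite /dnbhs /within /= => nP.
    have H : \forall k \near \oo, t_ k != 0 -> P (t_ k) := cvg_harmonic nP.
    by apply: filterS H => k; apply; rewrite gt_eqF.
  move=> /(cvg_comp _ _ tc); apply: cvg_trans; apply: near_eq_cvg; near=> k.
  by rewrite /q /= addr0 [_ *: 1]mulr1 rot0 mulmx1.
have dcv : (\int[sigma]_(x in (sphere : set (borel_rV R n))) (q k x)%:E)%E @[k --> \oo]
    --> (\int[sigma]_(x in (sphere : set (borel_rV R n))) (D x)%:E)%E.
  have [||||| _ _ //] := @dominated_convergence _ _ _ sigma
    (sphere : set (borel_rV R n)) mS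
    (fun k x => (q k x)%:E) (fun x => (D x)%:E) (fun=> C%:E).
  - by move=> k; apply/measurable_EFinP; exact: (measurable_fun_sphere (qc k)).
  - by apply/measurable_EFinP; exact: (measurable_fun_sphere Dc).
  - apply: aeW => x Sx; apply/fine_cvgP; split; first exact: nearW.
    exact: qD.
  - exact: (finite_measure_integrable_cst sigma C mS).
  - by apply: aeW => x k Sx; rewrite /= lee_fin; exact: qC.
have q0' k : (\int[sigma]_(x in (sphere : set (borel_rV R n))) (q k x)%:E)%E = 0%E.
  rewrite -[LHS]fineK; first by have := q0 k; rewrite /Rintegral => ->.
  by apply: integrable_fin_num => //; exact: (sphere_integrable sigma (qc k)).
have E : (\int[sigma]_(x in (sphere : set (borel_rV R n))) (D x)%:E)%E = 0%E.
  rewrite -(cvg_lim _ dcv)//; apply: cvg_lim => //.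
  rewrite (_ : (fun k => _) = cst 0%E); first exact: cvg_cst.
  by apply/funext => k; exact: q0'.
exact: (congr1 fine E).
Unshelve. all: by end_near. Qed.

(** The field [x |-> x *m angular i j] generates the rotations of the plane of the
coordinates [i] and [j]. *)
Definition angular (i j : 'I_n) : 'M[R]_n := delta_mx i j - delta_mx j i.

Lemma mul_angular x i j (d : 'rV[R]_n) :
  dot (x *m angular i j) d = x 0 i * d 0 j - x 0 j * d 0 i.
Proof.
have E k l : x *m delta_mx k l = x 0 k *: delta_mx 0 l.
  apply/rowP => m; rewrite !mxE (bigD1 k)//= big1 => [|p pk].
    by rewrite mxE eqxx addr0.
  by rewrite mxE (negPf pk) mulr0.
by rewrite /angular mulmxBr dotDl dotNl !E !dotZl !dot_delta.
Qed.

Lemma angular_skew i j : (angular i j)^T = - angular i j.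
Proof. by rewrite /angular linearB /= !trmx_delta opprB. Qed.

Lemma angular_cube i j : i != j ->
  angular i j *m angular i j *m angular i j = - angular i j.
Proof.
move=> ij; have ji : j != i by rewrite eq_sym.
have -> : angular i j *m angular i j = - (delta_mx i i + delta_mx j j).
  rewrite /angular mulmxBl !mulmxBr !mul_delta_mx !mul_delta_mx_0//.
  by rewrite sub0r subr0 opprD.
rewrite mulNmx /angular mulmxDl !mulmxBr !mul_delta_mx !mul_delta_mx_0//.
by rewrite subr0 sub0r.
Qed.

Lemma Rintegral_angular sigma F (G : 'rV[R]_n -> 'rV[R]_n) (i j : 'I_n) :
  uniform_sphere sigma ->
  (forall x, sphere x -> hasgrad F x (G x)) ->
  (forall k, {within sphere, continuous (fun x => G x 0 k)}) ->
  \int[sigma]_(x in sphere) (x 0 i * G x 0 j - x 0 j * G x 0 i) = 0.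
Proof.
move=> su FG Gc; have [->|ij] := eqVneq i j.
  under eq_Rintegral do rewrite subrr.
  by rewrite Rintegral_cst ?mul0r//; exact: measurable_sphere.
have cc k : {within sphere, continuous (fun x : 'rV[R]_n => x 0 k)}.
  exact: smooth_continuous (smooth_coord k).
under eq_Rintegral do rewrite -mul_angular.
apply: (Rintegral_rotation_generator su (angular_skew i j) (angular_cube ij) FG).
under eq_fun do rewrite mul_angular.
have xGc k l : {within sphere, continuous (fun x => x 0 k * G x 0 l)}.
  exact: within_continuousM.
exact: within_continuousB.
Qed.

(** Divergence theorem on the sphere. For the coordinate [f] of the field along [i],
the fields [angular k i] applied to [z 0 k * f z] add up over [k] to
[\partial_i f - (n - 1) x_i f]; the terms [x_i f] cancel by tangency. *)
Lemma divergence_sphere sigma (Y : 'rV[R]_n -> 'rV[R]_n) (J : 'rV[R]_n -> 'M[R]_n) :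
  uniform_sphere sigma ->
  (forall x, sphere x -> hasjac (Y \o normalize) x (J x)) ->
  (forall i j, {within sphere, continuous (fun x => J x i j)}) ->
  (forall x, sphere x -> dot x (Y x) = 0) ->
  \int[sigma]_(x in sphere) \tr (J x) = 0.
Proof.
move=> su YJ Jc Yt; have mS := @measurable_sphere R n.
have Yc i : {within sphere, continuous (fun x => Y x 0 i)}.
  apply: continuous_sphere => x Sx.
  exact: (hasgrad_continuous (YJ x Sx i)).
have cc k : {within sphere, continuous (fun x : 'rV[R]_n => x 0 k)}.
  exact: smooth_continuous (smooth_coord k).
pose G k i x : 'rV[R]_n := x 0 k *: (col i (J x))^T + Y x 0 i *: delta_mx 0 k.
have GE k i x l : G k i x 0 l = x 0 k * J x l i + Y x 0 i * (l == k)%:R.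
  by rewrite !mxE eqxx.
have FG k i x : sphere x ->
    hasgrad (fun z => z 0 k * (Y \o normalize) z 0 i) x (G k i x).
  move=> Sx; have := hasgradM (hasgrad_coord k x) (YJ x Sx i).
  by rewrite /= (normalize_sphere Sx).
have Gc k i l : {within sphere, continuous (fun x => G k i x 0 l)}.
  under eq_fun do rewrite GE; apply: within_continuousD.
    exact: within_continuousM.
  apply: within_continuousM => //.
  by apply: continuous_subspaceT => x; exact: cst_continuous.
have L0 k i := Rintegral_angular k i su (FG k i) (Gc k i).
pose L k i x := x 0 k * G k i x 0 i - x 0 i * G k i x 0 k.
have Lc k i : {within sphere, continuous (L k i)}.
  have xGc a b : {within sphere, continuous (fun x => x 0 a * G k i x 0 b)}.
    exact: within_continuousM.
  exact: within_continuousB.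
have sum0 (s : seq ('I_n * 'I_n)) :
    \int[sigma]_(x in sphere) (\sum_(p <- s) L p.1 p.2 x) = 0.
  elim: s => [|p s IH].
    under eq_Rintegral do rewrite big_nil.
    by rewrite Rintegral_cst// mul0r.
  under eq_Rintegral do rewrite big_cons.
  rewrite RintegralD//.
  - by rewrite IH addr0; exact: L0.
  - exact: (sphere_integrable sigma (Lc p.1 p.2)).
  - apply: sphere_integrable.
    exact: (@within_continuous_sum _ _ _ _ s (fun p => L p.1 p.2) (fun p => Lc p.1 p.2)).
rewrite -[RHS](sum0 (index_enum _)); apply: eq_Rintegral => x; rewrite inE => Sx.
rewrite -(pair_bigA _ (fun k i => L k i x)) exchange_big /=.
have xJ i : \sum_k x 0 k * J x k i = 0.
  have := hasjac_hat_radial (sphere_neq0 Sx) (YJ x Sx).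
  by move/rowP/(_ i); rewrite !mxE.
have -> : \tr (J x) = \sum_i (J x i i - (n%:R - 1) * (x 0 i * Y x 0 i)).
  by rewrite sumrB -mulr_sumr -/(dot x (Y x)) Yt// mulr0 subr0.
apply: eq_bigr => i _.
transitivity (\sum_k (J x i i * (x 0 k * x 0 k) + x 0 i * Y x 0 i * (i == k)%:R
   - (x 0 i * (x 0 k * J x k i) + x 0 i * Y x 0 i))); last first.
  apply: eq_bigr => k _; rewrite /L !GE eqxx mulr1.
  by case: eqVneq => [->|_] /=; rewrite ?mulr1n ?mulr0n; ring.
rewrite sumrB !big_split /= -!mulr_sumr xJ -/(dot x x) Sx mulr1 mulr0 add0r.
rewrite sumr_const card_ord (bigD1 i)//= eqxx big1 => [|k ki].
  by rewrite mulr1n addr0 -[_ *+ n]mulr_natl; ring.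
by rewrite eq_sym (negPf ki).
Qed.

End Rotation.

(** * Integration by parts *)

Section IntegrationByParts.
Context {R : realType} {n : nat}.
Variables (sigma mu nu : probability (borel_rV R n) R).
Variables (V W h : 'rV[R]_n -> R).
Implicit Types (f g u : 'rV[R]_n -> R) (x y : 'rV[R]_n).

Notation S := (sphere : set (borel_rV R n)).

Hypothesis sigma_unif : uniform_sphere sigma.
Hypothesis mu_density : gibbs sigma V mu.
Hypothesis nu_density : gibbs sigma W nu.
Hypothesis W_smooth : smooth (fun x => expR (- W x)).
Hypothesis h_smooth : smooth h.
Hypothesis T_smooth : forall i : 'I_n, smooth (fun x => Tmap h x 0 i).
Hypothesis h_gt0 : forall x, sphere x -> 0 < h x.
Hypothesis h_pos : D2_pos h.
Hypothesis T_transports : transports mu nu (Tmap h).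

Let w x := expR (- W x).

(** The smooth object is the density [expR (- W)], of which [W] is the opposite of the
logarithm. *)
Lemma sgrad_potential x : sphere x ->
  hasgrad (W \o normalize) x (sgrad W x) /\ sgrad W x = - (w x)^-1 *: sgrad w x.
Proof.
move=> Sx; have w0 : 0 < (w \o normalize) x by exact: expR_gt0.
have := hasgradN (hasgrad_comp1 (smooth_hasgrad W_smooth (sphere_neq0 Sx)) (is_derive1_ln w0)).
rewrite (_ : (fun y => - ln _) = W \o normalize); last first.
  by apply/funext => y; rewrite /= expRK opprK.
rewrite /= (normalize_sphere Sx) -scaleNr => Wd.
by rewrite (sgrad_hasgrad Wd).
Qed.

Lemma smooth_mx_Tmap : smooth_mx (Tmap h).
Proof. by move=> i j; rewrite (ord1 i). Qed.

(** The square root is traded for a pairing of smooth fields: [grad1 h x] is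
[ray_norm h x] times the unit vector [Tmap h x]. *)
Lemma smooth_ray_norm : smooth (ray_norm h).
Proof.
apply: (@eq_smooth _ _ (fun x => dot (Tmap h x) (grad1 h x))).
  move=> x Sx; rewrite (grad1_ray h_smooth h_gt0 Sx) dotZr.
  by rewrite (sphere_Tmap h_smooth h_gt0 Sx) mulr1.
by apply: smooth_dot; [exact: smooth_mx_Tmap|exact: smooth_mx_grad1].
Qed.

Lemma smooth_mx_velocity u g : smooth u -> smooth g -> smooth_mx (velocity h u g).
Proof.
move=> us gs; apply: smooth_mxZ.
  apply: smoothM => //; apply: smoothV; last exact: smooth_ray_norm.
  by move=> x Sx; rewrite gt_eqF//; exact: ray_norm_gt0.
apply: smooth_mxM; first exact: smooth_mx_grad1.
apply: smooth_mxD; first exact: smooth_mx_cst.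
apply: smooth_mxN; apply: smooth_mxM; last exact: smooth_mx_Tmap.
exact: smooth_mxT smooth_mx_Tmap.
Qed.

Lemma smooth_mx_dTinv : smooth_mx (dTinv h).
Proof.
apply: smooth_mxD.
  by apply: smooth_mxM; [exact: smooth_mxT smooth_mx_Tmap|exact: smooth_mx_id].
apply: smooth_mxZ; first exact: smooth_ray_norm.
apply: smooth_mxM; last exact: smooth_mx_tinv.
apply: smooth_mxD; first exact: smooth_mx_cst.
apply: smooth_mxN; apply: smooth_mxZ.
  by apply: smoothV => // x Sx; rewrite gt_eqF// h_gt0.
by apply: smooth_mxM; [exact: smooth_mxT smooth_mx_id|exact: smooth_mx_grad1].
Qed.

Section Field.
Variables (f g : 'rV[R]_n -> R).
Hypotheses (f_smooth : smooth f) (g_smooth : smooth g).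

Let u x := h x * f x.
Let Z := velocity h u g.
Let B x := 'J (Z \o normalize) x.

Let u_smooth : smooth u. Proof. exact: smoothM. Qed.

Let Z_smooth : smooth_mx Z. Proof. exact: smooth_mx_velocity. Qed.

Lemma divergence_velocityE x : sphere x -> hasjac (Z \o normalize) x (B x) /\
  \tr (dTinv h x *m B x) - dot (sgrad W (Tmap h x)) (Z x) =
  h x * dot (sgrad g x) (sgrad f x *m tinv x (D2 h x)) + g x * Lop W h f x.
Proof.
move=> Sx; have ST := sphere_Tmap h_smooth h_gt0 Sx.
have TW : dot (Tmap h x) (sgrad W (Tmap h x)) = 0.
  exact: hasgrad_hat_radial (sphere_neq0 ST) (sgrad_potential ST).1.
have [B' JB' E] := divergence_velocity h_smooth h_gt0 h_pos f_smooth g_smooth Sx TW.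
have BE : B x = B' := hasjac_jacobian JB'.
by rewrite BE E addrK; split.
Qed.

Let B_smooth : smooth_mx B.
Proof.
by apply: (smooth_jacobian Z_smooth) => x Sx; have [] := divergence_velocityE Sx.
Qed.

Let Tinv_continuous : {within sphere, continuous (Tinv h)}.
Proof.
apply: continuous_sphere => x Sx.
exact: (continuous_Tinv h_smooth h_gt0 h_pos (sphere_neq0 Sx)).
Qed.

Let comp_Tinv_continuous (q : 'rV[R]_n -> R) : {within sphere, continuous q} ->
  {within sphere, continuous (fun y => q (Tinv h y))}.
Proof.
move=> qc; apply: (within_continuous_selfcomp Tinv_continuous _ qc) => y Sy.
exact: sphere_Tinv.
Qed.

Let sgradW_continuous i : {within sphere, continuous (fun y => sgrad W y 0 i)}.
Proof.
have wVc : {within sphere, continuous (fun y => - (w y)^-1 * sgrad w y 0 i)}.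
  apply: smooth_continuous; apply: smoothM; last exact: smooth_sgrad.
  by apply: smoothN; apply: smoothV => // y _; rewrite gt_eqF// expR_gt0.
apply: (subspace_eq_continuous _ wVc) => y; rewrite inE => Sy.
by have [_ /rowP/(_ i)] := sgrad_potential Sy; rewrite [RHS]mxE /from_subspace.
Qed.

(** The field [Y = Z \o Tinv] is tangent to the sphere. By the divergence theorem for
[expR (- W) *: Y], the integral of [\tr J - dot (sgrad W) Y] against [nu] is 0; as
[Tmap h] transports [mu] to [nu], so is the integral against [mu] of its
composition with [Tmap h], which [divergence_velocityE] computes. *)
Lemma Rintegral_divergence_velocity :
  \int[mu]_(x in sphere)
     (h x * dot (sgrad g x) (sgrad f x *m tinv x (D2 h x)) + g x * Lop W h f x) = 0.
Proof.
have muS := gibbs_sphere mu_density; have sS := sigma_unif.1.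
pose Y y := Z (Tinv h y).
pose J y := dTinv h (Tinv h y) *m B (Tinv h y).
have SpT y : sphere y -> sphere (Tinv h y) by move=> Sy; exact: sphere_Tinv.
have JY y : sphere y -> hasjac (Y \o normalize) y (J y).
  move=> Sy; have Sx := SpT y Sy.
  have [JB _] := divergence_velocityE Sx.
  have := hasjac_comp_Tinv h_smooth h_gt0 h_pos Sx JB.
  by rewrite (TinvK h_smooth h_gt0 Sy).
have Yc i : {within sphere, continuous (fun y => Y y 0 i)}.
  exact: comp_Tinv_continuous (smooth_continuous (Z_smooth 0 i)).
have Jc i j : {within sphere, continuous (fun y => J y i j)}.
  have KBs : smooth_mx (fun x => dTinv h x *m B x).
    by apply: smooth_mxM => //; exact: smooth_mx_dTinv.
  exact: comp_Tinv_continuous (smooth_continuous (KBs i j)).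
have wc : {within sphere, continuous w} by exact: smooth_continuous.
pose psi y := \tr (J y) - dot (sgrad W y) (Y y).
have psic : {within sphere, continuous psi}.
  apply: within_continuousB.
    by apply: within_continuous_sum => i.
  by apply: within_continuous_sum => i; exact: within_continuousM.
pose Jw y := (sgrad w y)^T *m Y y + w y *: J y.
have JYw y : sphere y -> hasjac ((fun y => w y *: Y y) \o normalize) y (Jw y).
  move=> Sy; have := hasjacM (smooth_hasgrad W_smooth (sphere_neq0 Sy)) (JY y Sy).
  by rewrite /= (normalize_sphere Sy).
have Jwc i j : {within sphere, continuous (fun y => Jw y i j)}.
  rewrite (_ : (fun y => _) = (fun y => sgrad w y 0 i * Y y 0 j + w y * J y i j)).
    apply: within_continuousD; apply: within_continuousM => //.
    exact: smooth_continuous (smooth_sgrad i W_smooth).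
  apply/funext => y; rewrite /Jw; move: (sgrad w y) (Y y) (J y) => a b c.
  by rewrite !mxE big_ord1 mxE.
have Yt y : sphere y -> dot y (w y *: Y y) = 0.
  move=> Sy; rewrite dotZr -[X in dot X _](TinvK h_smooth h_gt0 Sy).
  by rewrite velocity_tangent ?mulr0//; exact: SpT.
have div0 := divergence_sphere sigma_unif JYw Jwc Yt.
have nu0 : \int[nu]_(y in sphere) psi y = 0.
  rewrite (Rintegral_gibbs sS nu_density wc psic) -[RHS]div0.
  apply: eq_Rintegral => y; rewrite inE => Sy.
  have w0 : w y != 0 by rewrite gt_eqF// expR_gt0.
  have [_ E] := sgrad_potential Sy.
  rewrite /psi /Jw E mxtraceD mxtraceZ mxtrace_mul_col_row dotZl (dotC (Y y)) -/(w y).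
  by field.
rewrite -[RHS]nu0 -(Rintegral_transports T_transports muS psic).
apply: eq_Rintegral => x; rewrite inE => Sx.
have [_ <-] := divergence_velocityE Sx.
by rewrite /psi /J /Y (TmapK h_smooth h_gt0 h_pos Sx).
Qed.

Lemma continuous_trace_velocity : {within sphere, continuous (fun x =>
  \tr (dTinv h x *m B x) - dot (sgrad W (Tmap h x)) (Z x))}.
Proof.
have Tc := continuous_Tmap h_smooth h_gt0.
apply: within_continuousB.
  apply: smooth_continuous; apply: smooth_mxtrace; apply: smooth_mxM => //.
  exact: smooth_mx_dTinv.
apply: within_continuous_sum => i; apply: within_continuousM.
  apply: (@within_continuous_selfcomp _ _ _ _ (fun y => sgrad W y 0 i) Tc) => // x.
  exact: sphere_Tmap.
exact: smooth_continuous (Z_smooth 0 i).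
Qed.

End Field.

Lemma sgrad_cst (a : R) x : x != 0 -> sgrad (fun=> a) x = 0.
Proof. by move=> x0; apply: sgrad_hasgrad; exact: hasgrad_cst. Qed.

(** [Lop] is the integrand of the previous lemmas for the weight [g = 1]. *)
Lemma continuous_Lop f : smooth f -> {within sphere, continuous (Lop W h f)}.
Proof.
move=> fs; have c1 := @smooth_cst R n 1.
apply: (subspace_eq_continuous _ (continuous_trace_velocity fs c1)) => x.
rewrite inE /from_subspace => Sx; have [_ ->] := divergence_velocityE fs c1 Sx.
by rewrite (sgrad_cst _ (sphere_neq0 Sx)) dot0l mulr0 add0r mul1r.
Qed.

Lemma smooth_energy_density f g : smooth f -> smooth g ->
  smooth (fun x => h x * dot (sgrad g x) (sgrad f x *m tinv x (D2 h x))).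
Proof.
move=> fs gs; apply: smoothM => //; apply: smooth_dot; first exact: smooth_mx_sgrad.
by apply: smooth_mxM; [exact: smooth_mx_sgrad|exact: smooth_mx_tinv].
Qed.

Lemma energyE f g : smooth f -> smooth g ->
  dirichlet_energy mu h g f = - \int[mu]_(x in sphere) (g x * Lop W h f x).
Proof.
move=> fs gs; apply/eqP; rewrite -addr_eq0; apply/eqP.
rewrite -[RHS](Rintegral_divergence_velocity fs gs) RintegralD//.
- exact: measurable_sphere.
- exact: (sphere_integrable mu (smooth_continuous (smooth_energy_density fs gs))).
- apply: sphere_integrable; apply: within_continuousM; last exact: continuous_Lop.
  exact: smooth_continuous.
Qed.

(** * The Dirichlet form *)

Let E := dirichlet_energy mu h.

Let E_int f g : smooth f -> smooth g -> mu.-integrable S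
  (EFin \o (fun x => h x * dot (sgrad g x) (sgrad f x *m tinv x (D2 h x)))).
Proof.
by move=> fs gs; exact: (sphere_integrable mu (smooth_continuous (smooth_energy_density fs gs))).
Qed.

Lemma sgrad_linear (a : R) f g x : smooth f -> smooth g -> x != 0 ->
  sgrad (fun y => a * f y + g y) x = a *: sgrad f x + sgrad g x.
Proof.
move=> fs gs x0; apply: sgrad_hasgrad.
exact: hasgradD (hasgradZ a (smooth_hasgrad fs x0)) (smooth_hasgrad gs x0).
Qed.

Lemma energy_sym f g : smooth f -> smooth g -> E f g = E g f.
Proof.
move=> fs gs; apply: eq_Rintegral => x; rewrite inE => Sx.
by rewrite dotC dot_mulmx (tinv_sym h_smooth h_pos Sx).
Qed.

Lemma energy_linear (a : R) f1 f2 g : smooth f1 -> smooth f2 -> smooth g ->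
  E (fun x => a * f1 x + f2 x) g = a * E f1 g + E f2 g.
Proof.
move=> fs1 fs2 gs; have mS := @measurable_sphere R n.
have i1 := E_int gs fs1; have i2 := E_int gs fs2.
rewrite /E /dirichlet_energy -(RintegralZl a mS i1).
rewrite -RintegralD//; last first.
  apply: (sphere_integrable mu); apply: smooth_continuous.
  by apply: smoothM; [exact: smooth_cst|exact: smooth_energy_density].
apply: eq_Rintegral => x; rewrite inE => Sx.
by rewrite (sgrad_linear _ fs1 fs2 (sphere_neq0 Sx)) dotDl dotZl; ring.
Qed.

Lemma energy_ge0 f : smooth f -> 0 <= E f f.
Proof.
move=> fs; apply: Rintegral_ge0 => x Sx.
by rewrite mulr_ge0 ?(ltW (h_gt0 Sx))// (tinv_ge0 h_pos).
Qed.

Lemma smooth_lin (a : R) f g : smooth f -> smooth g -> smooth (fun x => a * f x + g x).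
Proof. by move=> fs gs; apply: smoothD => //; apply: smoothM => //; exact: smooth_cst. Qed.

Lemma energy_sub f g : smooth f -> smooth g ->
  E (f \- g) (f \- g) = E f f - 2 * E f g + E g g.
Proof.
move=> fs gs; pose d x := (-1) * g x + f x.
have -> : f \- g = d by apply/funext => x; rewrite /= /d mulN1r addrC.
have ds : smooth d := smooth_lin (-1) gs fs.
have lin e : smooth e -> E d e = (-1) * E g e + E f e := energy_linear (-1) gs fs.
rewrite (lin d ds) (energy_sym gs ds) (energy_sym fs ds) (lin g gs) (lin f fs).
by rewrite (energy_sym gs fs); move: (E _ _) (E _ _) (E _ _) => a b c; ring.
Qed.

(** [E f_k f_k <= E (f_k - f_l) (f_k - f_l) + 2 * E f_k f_l]. The first term is small
for [k] and [l] large; once [l] is fixed, the integration by parts puts both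
derivatives on [f_l] and the second term tends to 0 with the L^2 norm of [f_k]. *)
Lemma energy_closable (f_ : nat -> 'rV[R]_n -> R) : (forall k, smooth (f_ k)) ->
  (fun p : nat * nat => E (f_ p.1 \- f_ p.2) (f_ p.1 \- f_ p.2))
    @ (\oo, \oo) --> (0 : R) ->
  (fun k => \int[mu]_(x in sphere) (f_ k x ^+ 2))%R @ \oo --> (0 : R) ->
  (fun k => E (f_ k) (f_ k)) @ \oo --> (0 : R).
Proof.
move=> fs cauchy L2; have mS := @measurable_sphere R n.
apply/cvgrPdist_lt => e e0.
have e2 : 0 < e / 2 by rewrite divr_gt0.
have /cvgrPdist_lt/(_ _ e2)[[A B] /= [[N1 _ HA] [N2 _ HB]] HAB] := cauchy.
pose l := maxn N1 N2.
have Lc := continuous_Lop (fs l).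
have [C C0 LC] := sphere_bounded Lc.
pose d := e / (4 * C ^+ 2).
have d0 : 0 < d by rewrite divr_gt0// mulr_gt0// exprn_gt0.
have de : 0 < d * (e / 8) by rewrite mulr_gt0// divr_gt0.
have /cvgrPdist_lt/(_ _ de) L2d := L2.
near=> k.
have Nk : (N1 <= k)%N by near: k; exists N1.
have h1 : E (f_ k \- f_ l) (f_ k \- f_ l) < e / 2.
  have := HAB (k, l) (conj (HA _ Nk) (HB _ (leq_maxr N1 N2))).
  by rewrite /= sub0r normrN; apply: le_lt_trans; exact: ler_norm.
have f2int : mu.-integrable S (EFin \o (fun x => f_ k x ^+ 2)).
  apply: sphere_integrable; apply: smooth_continuous.
  by apply: smoothM.
have h2 : \int[mu]_(x in sphere) (f_ k x ^+ 2) < d * (e / 8).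
  have : `|0 - \int[mu]_(x in sphere) (f_ k x ^+ 2)| < d * (e / 8).
    by near: k.
  by rewrite sub0r normrN; apply: le_lt_trans; exact: ler_norm.
(* Young's inequality [- 2 * a * b <= d^-1 * a ^+ 2 + d * b ^+ 2], where [d] is such
   that the bound [C] of [Lop W h (f_ l)] contributes at most [e / 4]. *)
have h3 : 2 * E (f_ k) (f_ l) <= d^-1 * \int[mu]_(x in sphere) (f_ k x ^+ 2) + e / 4.
  rewrite /E energyE// mulrN -mulNr -RintegralZl//; last first.
    apply: sphere_integrable; apply: within_continuousM => //.
    exact: smooth_continuous.
  rewrite -RintegralZl//.
  have -> : e / 4 = \int[mu]_(x in sphere) (e / 4).
    have mu1 : fine (mu S) = 1 := congr1 fine (gibbs_sphere mu_density).
    by rewrite Rintegral_cst// [RHS](congr1 (fun t => e / 4 * t) mu1) mulr1.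
  rewrite -RintegralD//; last 2 first.
  - apply: sphere_integrable; apply: smooth_continuous.
    by apply: smoothM; [exact: smooth_cst|exact: smoothM].
  - by apply: sphere_integrable; apply: smooth_continuous; exact: smooth_cst.
  apply: le_Rintegral => //.
  - apply: sphere_integrable; apply: within_continuousM.
      by apply: smooth_continuous; exact: smooth_cst.
    by apply: within_continuousM => //; exact: smooth_continuous.
  - apply: sphere_integrable; apply: smooth_continuous; apply: smoothD.
      by apply: smoothM; [exact: smooth_cst|exact: smoothM].
    exact: smooth_cst.
  - move=> x Sx; have := LC x Sx; set a := f_ k x; set b := Lop _ _ _ _ => bC.
    have b2 : d * b ^+ 2 <= e / 4.
      have -> : e / 4 = d * C ^+ 2 by rewrite /d; field; rewrite gt_eqF.
      rewrite ler_wpM2l ?(ltW d0)// -[b ^+ 2]real_normK ?num_real//.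
      by rewrite ler_pXn2r// nnegrE// ltW.
    apply: le_trans (_ : d^-1 * a ^+ 2 + d * b ^+ 2 <= _); last by rewrite lerD2l.
    rewrite -subr_ge0 (_ : _ - _ = d^-1 * (a + d * b) ^+ 2).
      by rewrite mulr_ge0 ?sqr_ge0// invr_ge0 ltW.
    by field; rewrite gt_eqF.
have h4 := energy_sub (fs k) (fs l).
have h5 := energy_ge0 (fs l); have h6 := energy_ge0 (fs k).
have h7 : d^-1 * \int[mu]_(x in sphere) (f_ k x ^+ 2) < e / 8.
  by rewrite ltr_pdivrMl.
rewrite sub0r normrN ger0_norm//; move: h1 h3 h4 h5 h7; rewrite {h6}.
move: (E (f_ k \- f_ l) _) (E (f_ k) (f_ l)) (E (f_ k) (f_ k)) (E (f_ l) (f_ l)).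
by move: (d^-1 * _) => i a b c p *; lra.
Unshelve. all: by end_near. Qed.

Lemma energy_soft_clip (e : R) f : 0 < e -> smooth f ->
  E (soft_clip e \o f) (soft_clip e \o f) <= E f f.
Proof.
move=> e0 fs; have ps := smooth_soft_clip e fs.
apply: le_Rintegral; [exact: measurable_sphere|exact: E_int|exact: E_int|].
move=> x Sx; have x0 := sphere_neq0 Sx.
have d1 : derivable (soft_clip e) ((f \o normalize) x) (1 : R).
  exact: soft_clip_derivable.
have pd := hasgrad_comp1 (smooth_hasgrad fs x0) (derivableP d1).
rewrite (@sgrad_hasgrad _ _ (soft_clip e \o f) x _ pd).
have /andP[] := soft_clip_derive_itv e0 ((f \o normalize) x).
set c := 'D_(1 : R) _ _ => c0 c1.
rewrite ler_wpM2l ?(ltW (h_gt0 Sx))// -scalemxAl dotZl dotZr mulrA.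
rewrite ler_piMl ?(tinv_ge0 h_pos)//.
by rewrite mulr_ile1.
Qed.

Lemma symmetric_dirichlet_energy : symmetric_dirichlet mu smooth E.
Proof.
split.
- exact: smooth_lin.
- move=> f fs; apply: (sphere_integrable mu (f := fun x => f x ^+ 2)).
  by apply: smooth_continuous; exact: smoothM.
- exact: energy_linear.
- exact: energy_sym.
- exact: energy_ge0.
- exact: energy_closable.
- move=> e e0; exists (soft_clip e); split.
  + exact: soft_clip_id.
  + exact: soft_clip_itv.
  + exact: soft_clip_lip.
  + by move=> f fs; split; [exact: smooth_soft_clip|exact: energy_soft_clip].
Qed.

End IntegrationByParts.

Theorem theorem4p1 (R : realType) (n : nat)
    (sigma mu nu : probability (borel_rV R n) R) (V W h : 'rV[R]_n -> R)
    (sigma_unif : uniform_sphere sigma)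
    (mu_density : gibbs sigma V mu) (nu_density : gibbs sigma W nu)
    (V_smooth : smooth (fun x => expR (- V x)))
    (W_smooth : smooth (fun x => expR (- W x)))
    (h_smooth : smooth h)
    (T_smooth : forall i : 'I_n, smooth (fun x => Tmap h x 0 i))
    (h_gt0 : forall x, sphere x -> 0 < h x)
    (h_support : is_support_function h)
    (h_pos : D2_pos h)
    (T_opt : optimal_transport mu nu (Tmap h)) :
  symmetric_dirichlet mu smooth (dirichlet_energy mu h) /\
  forall u g : 'rV[R]_n -> R, smooth u -> smooth g ->
    (\int[mu]_(x in sphere)
       (h x * dot (sgrad g x)
                  (sgrad (fun y => u y / h y) x *m tinv x (D2 h x))))%R =
    - (\int[mu]_(x in sphere)
         (g x * Lop W h (fun y => u y / h y) x))%R.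
Proof.
have [T_transports _] := T_opt; split.
  exact: (symmetric_dirichlet_energy sigma_unif mu_density nu_density).
move=> u g us gs.
have fs : smooth (fun y => u y / h y).
  apply: smoothM => //; apply: smoothV => // x Sx.
  by rewrite gt_eqF// h_gt0.
exact: (energyE sigma_unif mu_density nu_density W_smooth h_smooth T_smooth
  h_gt0 h_pos T_transports fs gs).
Qed.
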